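(* Let $M$ and $N$ be $\lambda$-terms. Suppose there exist a reduct $N'$ of $N$ and a simple reduct $M'$ of $M$ such that $\mathrm{BT}(M') = \mathrm{BT}(N')$ and there are infinitely many positions $p$ at which both $\mathrm{cBT}(M')$ and $\mathrm{cBT}(N')$ are annotated, with annotations $k_1$ and $k_2$ respectively satisfying $k_1 > k_2$. Then $M \neq_\beta N$.
   Context: Untyped $\lambda$-calculus with $\beta$-reduction; a reduct of $M$ is any $M'$ with $M \twoheadrightarrow_\beta M'$. A redex $(\lambda x.A)B$ is simple if $x$ occurs at most once in $A$ or $B$ is a $\beta$-normal form. A head reduction step is a step $\lambda x_1\ldots x_n.(\lambda y.P)Q Q_1\ldots Q_m \to \lambda x_1\ldots x_n.P[y:=Q] Q_1\ldots Q_m$; a head normal form (hnf) is $\lambda x_1\ldots x_n.\,y M_1\ldots M_m$. A term $t$ is simple (coinductively) if either $t$ has no hnf, or the head reduction of $t$ to hnf $\lambda x_1\ldots x_n.\,y M_1\ldots M_m$ contracts only simple redexes and $M_1,\ldots,M_m$ are simple. The clocked Böhm tree $\mathrm{cBT}(t)$: if $t$ has no hnf, $\mathrm{cBT}(t)=\bot$ (unannotated); otherwise $t$ head-reduces in $k$ steps to an hnf $\lambda x_1\ldots x_n.\,y M_1\ldots M_m$ and $\mathrm{cBT}(t)$ is $\lambda x_1\ldots x_n.\,y\,\mathrm{cBT}(M_1)\ldots\mathrm{cBT}(M_m)$ with root annotated by $k$. $\mathrm{BT}(t)$ is $\mathrm{cBT}(t)$ with annotations erased. Positions are finite sequences over $\{0,1,2\}$.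 *)

(* Defs.v *)
From Stdlib Require Import Arith List Relations.
Import ListNotations.

Inductive term : Type :=
| Var : nat -> term
| Lam : term -> term
| App : term -> term -> term.

Fixpoint lift (d c : nat) (t : term) : term :=
  match t with
  | Var x => if x <? c then Var x else Var (x + d)
  | Lam u => Lam (lift d (S c) u)
  | App u v => App (lift d c u) (lift d c v)
  end.

Fixpoint subst (j : nat) (s : term) (t : term) : term :=
  match t with
  | Var x => if x =? j then lift j 0 s
             else if j <? x then Var (x - 1) else Var x
  | Lam u => Lam (subst (S j) s u)
  | App u v => App (subst j s u) (subst j s v)
  end.

Inductive beta : term -> term -> Prop :=
| beta_redex : forall A B, beta (App (Lam A) B) (subst 0 B A)
| beta_lam : forall M M', beta M M' -> beta (Lam M) (Lam M')
| beta_appl : forall M M' N, beta M M' -> beta (App M N) (App M' N)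
| beta_appr : forall M N N', beta N N' -> beta (App M N) (App M N').

Definition beta_star : term -> term -> Prop := clos_refl_trans term beta.
Definition beta_conv : term -> term -> Prop := clos_refl_sym_trans term beta.

Definition beta_nf (t : term) : Prop := forall t', ~ beta t t'.

Fixpoint occ (j : nat) (t : term) : nat :=
  match t with
  | Var x => if x =? j then 1 else 0
  | Lam u => occ (S j) u
  | App u v => occ j u + occ j v
  end.

Definition simple_redex (A B : term) : Prop := occ 0 A <= 1 \/ beta_nf B.

Inductive hstep_r : term -> term -> term -> term -> Prop :=
| hs_redex : forall A B, hstep_r (App (Lam A) B) (subst 0 B A) A B
| hs_lam : forall M M' A B, hstep_r M M' A B -> hstep_r (Lam M) (Lam M') A B
| hs_app : forall M M' N A B,
    (forall P, M <> Lam P) -> hstep_r M M' A B -> hstep_r (App M N) (App M' N) A B.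

Definition hstep (t t' : term) : Prop := exists A B, hstep_r t t' A B.

Inductive hred_n : nat -> term -> term -> Prop :=
| hred_0 : forall t, hred_n 0 t t
| hred_S : forall k t t' u, hstep t t' -> hred_n k t' u -> hred_n (S k) t u.

Inductive hred_simple : term -> term -> Prop :=
| hrs_0 : forall t, hred_simple t t
| hrs_S : forall t t' u A B,
    hstep_r t t' A B -> simple_redex A B -> hred_simple t' u -> hred_simple t u.

Fixpoint lams (n : nat) (t : term) : term :=
  match n with 0 => t | S n' => Lam (lams n' t) end.

Definition apps (t : term) (args : list term) : term := fold_left App args t.

Definition hnf_of (n y : nat) (args : list term) : term := lams n (apps (Var y) args).

Definition has_hnf (t : term) : Prop :=
  exists k n y args, hred_n k t (hnf_of n y args).

CoInductive simple : term -> Prop :=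
| simple_nohnf : forall t, ~ has_hnf t -> simple t
| simple_hnf : forall t n y args,
    hred_simple t (hnf_of n y args) ->
    (forall a, In a args -> simple a) -> simple t.

CoInductive bt_eq : term -> term -> Prop :=
| bt_bot : forall t s, ~ has_hnf t -> ~ has_hnf s -> bt_eq t s
| bt_node : forall t s k1 k2 n y a1 a2,
    hred_n k1 t (hnf_of n y a1) -> hred_n k2 s (hnf_of n y a2) ->
    length a1 = length a2 ->
    (forall i a b, nth_error a1 i = Some a -> nth_error a2 i = Some b -> bt_eq a b) ->
    bt_eq t s.

(* annot t p k : cBT(t) is annotated at position p with k.
   Positions: 0 = body of an abstraction, 1 = function part, 2 = argument
   part of an application; the root of a node \x1..xn. y M1..Mm is the
   position of the outermost abstraction, and cBT(M_(i+1)) sits at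
   0^n 1^(m-1-i) 2 relative to it. *)
Inductive annot : term -> list nat -> nat -> Prop :=
| annot_root : forall t k n y args,
    hred_n k t (hnf_of n y args) -> annot t [] k
| annot_sub : forall t k n y args i a q k',
    hred_n k t (hnf_of n y args) -> nth_error args i = Some a ->
    annot a q k' ->
    annot t (repeat 0 n ++ repeat 1 (length args - 1 - i) ++ [2] ++ q) k'.

Definition infinite_set {T : Type} (P : T -> Prop) : Prop :=
  forall l : list T, exists x, P x /\ ~ In x l.

(* Main.v *)
From Stdlib Require Import Arith List Relations Lia Permutation Classical.
Require Import Defs.
Import ListNotations.

(** Clocks can only decrease under reduction, so if [M'] and [N'] had a common
    reduct [L], then [L] would be strictly faster than [M'] at infinitely many
    positions.  On the other hand [n] reduction steps from a simple term can
    lower the annotations by at most [n] in total.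

    Simplicity itself is not preserved by reduction, since discarded subterms
    may become badly behaved.  A finite exploration of [cBT(t)] is therefore
    represented by a linear approximant of [t], in which every argument is
    replaced by the finite list ("bag") of those of its copies that the
    exploration uses.  Every reduction step of an approximant removes exactly
    one abstraction, so the number of abstractions computes the sum of the
    annotations.  An approximant of a simple term uses at most one copy of any
    argument that is not a normal form, at every stage of its evaluation; this
    property is preserved by reduction of [t], and it implies that each redex
    of [t] has at most one copy in the approximant. *)

(** * Substitution, confluence and monotonicity of clocks *)

(** Substitution is developed for arbitrary maps on indices, where the commutation laws are
    pointwise equations; [lift] and [subst] are then recognised as instances. *)
Fixpoint ren (xi : nat -> nat) (t : term) : term :=
  match t with
  | Var x => Var (xi x)
  | Lam u => Lam (ren (fun x => match x with 0 => 0 | S y => S (xi y) end) u)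
  | App u v => App (ren xi u) (ren xi v)
  end.

Definition up (s : nat -> term) (x : nat) : term :=
  match x with 0 => Var 0 | S y => ren S (s y) end.

Fixpoint sub (s : nat -> term) (t : term) : term :=
  match t with
  | Var x => s x
  | Lam u => Lam (sub (up s) u)
  | App u v => App (sub s u) (sub s v)
  end.

Definition inst (B : term) (x : nat) : term :=
  match x with 0 => B | S y => Var y end.

Lemma ren_ext t : forall xi zeta, (forall x, xi x = zeta x) -> ren xi t = ren zeta t.
Proof.
  induction t; simpl; intros xi zeta E; f_equal; auto.
  apply IHt. intros [|x]; congruence.
Qed.

Lemma sub_ext t : forall s s', (forall x, s x = s' x) -> sub s t = sub s' t.
Proof.
  induction t; simpl; intros s s' E; f_equal; auto.
  apply IHt. intros [|x]; simpl; congruence.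
Qed.

Lemma ren_as_sub t : forall xi, ren xi t = sub (fun x => Var (xi x)) t.
Proof.
  induction t; simpl; intros xi; f_equal; auto.
  rewrite IHt. apply sub_ext. intros [|x]; reflexivity.
Qed.

Lemma sub_ren t : forall s xi, sub s (ren xi t) = sub (fun x => s (xi x)) t.
Proof.
  induction t; simpl; intros s xi; f_equal; auto.
  rewrite IHt. apply sub_ext. intros [|x]; reflexivity.
Qed.

Lemma ren_ren t xi zeta : ren zeta (ren xi t) = ren (fun x => zeta (xi x)) t.
Proof. now rewrite (ren_as_sub (ren xi t)), sub_ren, <- ren_as_sub. Qed.

Lemma ren_sub t : forall s xi, ren xi (sub s t) = sub (fun x => ren xi (s x)) t.
Proof.
  induction t; simpl; intros s xi; f_equal; auto.
  rewrite IHt. apply sub_ext. intros [|x]; simpl; [reflexivity|].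
  now rewrite !ren_ren.
Qed.

Lemma sub_sub t : forall s s', sub s' (sub s t) = sub (fun x => sub s' (s x)) t.
Proof.
  induction t; simpl; intros s s'; f_equal; auto.
  rewrite IHt. apply sub_ext. intros [|x]; simpl; [reflexivity|].
  now rewrite sub_ren, ren_sub.
Qed.

Lemma sub_Var t : forall s, (forall x, s x = Var x) -> sub s t = t.
Proof.
  induction t; simpl; intros s E; f_equal; auto.
  apply IHt. intros [|x]; simpl; [reflexivity|]. now rewrite E.
Qed.

Lemma lift_ren t : forall d c, lift d c t = ren (fun x => if x <? c then x else x + d) t.
Proof.
  induction t; simpl; intros d c; f_equal; auto.
  - destruct (n <? c); reflexivity.
  - rewrite IHt. apply ren_ext. intros [|x]; [reflexivity|].
    change (S x <? S c) with (x <? c). destruct (x <? c); lia.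
Qed.

Lemma subst_sub_gen t : forall j s, subst j s t =
  sub (fun x => if x =? j then lift j 0 s else if j <? x then Var (x - 1) else Var x) t.
Proof.
  induction t; simpl; intros j s; f_equal; auto.
  rewrite IHt. apply sub_ext. intros [|x].
  - reflexivity.
  - change (S x =? S j) with (x =? j). change (S j <? S x) with (j <? x). simpl.
    destruct (Nat.eqb_spec x j).
    + rewrite !lift_ren, ren_ren. apply ren_ext. intros y. simpl. lia.
    + destruct (Nat.ltb_spec j x); simpl; f_equal; lia.
Qed.

Lemma subst_inst A B : subst 0 B A = sub (inst B) A.
Proof.
  rewrite subst_sub_gen. apply sub_ext. intros [|x]; simpl.
  - rewrite lift_ren. rewrite ren_as_sub. apply sub_Var. intros y. simpl. f_equal. lia.
  - f_equal. lia.
Qed.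

Lemma sub_subst A B s : sub s (subst 0 B A) = subst 0 (sub s B) (sub (up s) A).
Proof.
  rewrite !subst_inst, !sub_sub. apply sub_ext. intros [|x]; simpl; [reflexivity|].
  rewrite sub_ren. symmetry. now apply sub_Var.
Qed.

Lemma ren_subst A B xi : ren xi (subst 0 B A)
  = subst 0 (ren xi B) (ren (fun x => match x with 0 => 0 | S y => S (xi y) end) A).
Proof.
  rewrite !subst_inst, ren_sub, sub_ren. apply sub_ext. intros [|x]; reflexivity.
Qed.

(** * Parallel reduction and confluence *)

Inductive par : term -> term -> Prop :=
| par_var x : par (Var x) (Var x)
| par_lam A A' : par A A' -> par (Lam A) (Lam A')
| par_app M M' N N' : par M M' -> par N N' -> par (App M N) (App M' N')
| par_beta A A' B B' : par A A' -> par B B' -> par (App (Lam A) B) (subst 0 B' A').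

Lemma par_refl t : par t t.
Proof. induction t; now constructor. Qed.

Lemma par_ren t t' : par t t' -> forall xi, par (ren xi t) (ren xi t').
Proof.
  induction 1; simpl; intros xi; try (constructor; auto; fail).
  rewrite ren_subst. now constructor.
Qed.

Lemma par_sub t t' : par t t' -> forall s s', (forall x, par (s x) (s' x)) ->
  par (sub s t) (sub s' t').
Proof.
  assert (U : forall s s', (forall x, par (s x) (s' x)) -> forall x, par (up s x) (up s' x)).
  { intros s s' E [|x]; simpl; [constructor|]. now apply par_ren. }
  induction 1; simpl; intros s s' E; auto; try (constructor; auto; fail).
  rewrite sub_subst. constructor; auto.
Qed.

Lemma par_inst A A' B B' : par A A' -> par B B' -> par (subst 0 B A) (subst 0 B' A').
Proof.
  intros HA HB. rewrite !subst_inst. apply par_sub; [assumption|].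
  intros [|x]; [assumption|constructor].
Qed.

Lemma par_of_beta t s : beta t s -> par t s.
Proof. induction 1; constructor; auto using par_refl. Qed.

Lemma star_lam t s : beta_star t s -> beta_star (Lam t) (Lam s).
Proof.
  induction 1; [apply rt_step; now constructor|apply rt_refl|eapply rt_trans; eassumption].
Qed.

Lemma star_app t t' u u' : beta_star t t' -> beta_star u u' -> beta_star (App t u) (App t' u').
Proof.
  intros H H'. apply rt_trans with (App t' u).
  - clear H'. induction H; [apply rt_step; now constructor|apply rt_refl|eapply rt_trans; eassumption].
  - clear H. induction H'; [apply rt_step; now constructor|apply rt_refl|eapply rt_trans; eassumption].
Qed.

Lemma star_of_par t s : par t s -> beta_star t s.
Proof.
  induction 1.
  - apply rt_refl.
  - now apply star_lam.
  - now apply star_app.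
  - eapply rt_trans; [apply star_app; [apply star_lam|]; eassumption|].
    apply rt_step. constructor.
Qed.

(** Takahashi's complete development: all redexes present are contracted at once. *)
Fixpoint cdev (t : term) : term :=
  match t with
  | Var x => Var x
  | Lam u => Lam (cdev u)
  | App u v => match u with
               | Lam A => subst 0 (cdev v) (cdev A)
               | _ => App (cdev u) (cdev v)
               end
  end.

(** The triangle property: the target depends on [t] only, so any two parallel reducts of [t] meet
    there. *)
Lemma par_cdev t s : par t s -> par s (cdev t).
Proof.
  induction 1; simpl; try (constructor; auto; fail).
  - destruct M; try (constructor; auto; fail).
    inversion H; subst. simpl in IHpar1. inversion IHpar1; subst. now constructor.
  - now apply par_inst.
Qed.

Lemma par_star_strip t s : clos_refl_trans_1n term par t s -> forall u, par t u ->
  exists v, par s v /\ clos_refl_trans_1n term par u v.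
Proof.
  induction 1 as [t|t t' s H _ IH]; intros u Hu.
  - exists u. split; [assumption|constructor].
  - destruct (IH (cdev t)) as [v [Hv Hv']]; [now apply par_cdev|].
    exists v. split; [assumption|]. econstructor; [|eassumption]. now apply par_cdev.
Qed.

Lemma par_star_confluent t s : clos_refl_trans_1n term par t s ->
  forall u, clos_refl_trans_1n term par t u ->
  exists v, clos_refl_trans_1n term par s v /\ clos_refl_trans_1n term par u v.
Proof.
  induction 1 as [t|t t' s H _ IH]; intros u Hu.
  - exists u. split; [assumption|constructor].
  - destruct (par_star_strip _ _ Hu _ H) as [v [Hv Hv']].
    destruct (IH v Hv') as [z [Hz Hz']].
    exists z. split; [assumption|]. econstructor; eassumption.
Qed.

Lemma par_star_iff t s : clos_refl_trans_1n term par t s <-> beta_star t s.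
Proof.
  split; intro H.
  - induction H; [apply rt_refl|]. eapply rt_trans; [apply star_of_par|]; eassumption.
  - apply clos_rt_rt1n in H. induction H; [constructor|].
    econstructor; [apply par_of_beta|]; eassumption.
Qed.

Lemma church_rosser t s : beta_conv t s -> exists u, beta_star t u /\ beta_star s u.
Proof.
  induction 1 as [t s H|t|t s _ [u [H1 H2]]|t s u _ [v [H1 H2]] _ [v' [H3 H4]]].
  - exists s. split; [now apply rt_step|apply rt_refl].
  - exists t. split; apply rt_refl.
  - now exists u.
  - apply par_star_iff in H1, H2, H3, H4.
    destruct (par_star_confluent _ _ H2 _ H3) as [z [Hz Hz']].
    exists z. apply par_star_iff in H1, H4, Hz, Hz'.
    split; eapply rt_trans; eassumption.
Qed.

(** * Head reduction, annotations and their behaviour under reduction *)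

Definition neutral (t : term) : Prop := forall P, t <> Lam P.

Lemma hstep_lam_inv t s : hstep (Lam t) s -> exists s', s = Lam s' /\ hstep t s'.
Proof.
  intros [A [B H]]. inversion H; subst. eexists. split; [reflexivity|]. now exists A, B.
Qed.

Lemma hstep_r_det t s1 A1 B1 : hstep_r t s1 A1 B1 -> forall s2 A2 B2, hstep_r t s2 A2 B2 -> s1 = s2.
Proof.
  induction 1; intros s2 A2 B2 H'; inversion H'; subst; try reflexivity;
    try (match goal with E : forall P, Lam _ <> Lam P |- _ => now destruct (E _ eq_refl) end);
    f_equal; eauto.
Qed.

Lemma hstep_det t s1 s2 : hstep t s1 -> hstep t s2 -> s1 = s2.
Proof. intros [A1 [B1 H1]] [A2 [B2 H2]]. eapply hstep_r_det; eassumption. Qed.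

Lemma apps_snoc t l a : apps t (l ++ [a]) = App (apps t l) a.
Proof. unfold apps. now rewrite fold_left_app. Qed.

Lemma apps_var_not_lam y l : neutral (apps (Var y) l).
Proof.
  intros P. destruct l as [|a l _] using rev_ind; [discriminate|]. rewrite apps_snoc. discriminate.
Qed.

Lemma apps_var_no_hstep y l s : ~ hstep (apps (Var y) l) s.
Proof.
  revert s. induction l as [|a l IH] using rev_ind; intros s [A [B H]].
  - inversion H.
  - rewrite apps_snoc in H. inversion H; subst.
    + exact (apps_var_not_lam y l _ (eq_sym H1)).
    + apply (IH M'). now exists A, B.
Qed.

Lemma hnf_no_hstep n y l s : ~ hstep (hnf_of n y l) s.
Proof.
  revert s. induction n as [|n IH]; intros s H.
  - exact (apps_var_no_hstep _ _ _ H).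
  - apply hstep_lam_inv in H. destruct H as [s' [_ H]]. exact (IH _ H).
Qed.

Lemma apps_var_inj y l y' l' : apps (Var y) l = apps (Var y') l' -> y = y' /\ l = l'.
Proof.
  revert l'. induction l as [|a l IH] using rev_ind; intros l' E;
    destruct l' as [|a' l' _] using rev_ind.
  - inversion E. auto.
  - rewrite apps_snoc in E. discriminate.
  - rewrite apps_snoc in E. discriminate.
  - rewrite !apps_snoc in E. inversion E. destruct (IH l') as [-> ->]; auto.
Qed.

Lemma hnf_inj n y l n' y' l' : hnf_of n y l = hnf_of n' y' l' -> n = n' /\ y = y' /\ l = l'.
Proof.
  revert n'. induction n as [|n IH]; intros [|n'] E; unfold hnf_of in *; simpl in E.
  - apply apps_var_inj in E. tauto.
  - now apply apps_var_not_lam in E.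
  - symmetry in E. now apply apps_var_not_lam in E.
  - inversion E as [E']. apply IH in E'. intuition.
Qed.

Lemma hred_hnf_det k t n y l k' n' y' l' :
  hred_n k t (hnf_of n y l) -> hred_n k' t (hnf_of n' y' l') ->
  k = k' /\ n = n' /\ y = y' /\ l = l'.
Proof.
  intros H. remember (hnf_of n y l) as u eqn:E. revert k' E.
  induction H as [t|k t t1 u H _ IH]; intros k' -> H'.
  - inversion H'; subst.
    + match goal with E : _ = _ |- _ => apply hnf_inj in E end. intuition.
    + exfalso. eapply hnf_no_hstep; eassumption.
  - inversion H' as [t0 E|k0 t0 t2 u0 H1 H2]; subst.
    + exfalso. eapply hnf_no_hstep; eassumption.
    + rewrite (hstep_det _ _ _ H1 H) in H2. destruct (IH _ eq_refl H2) as [-> E]. auto.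
Qed.

Lemma repeat_one_two_inj m m' (q q' : list nat) :
  repeat 1 m ++ [2] ++ q = repeat 1 m' ++ [2] ++ q' -> m = m' /\ q = q'.
Proof.
  revert m'. induction m as [|m IH]; intros [|m'] E; simpl in E; inversion E; auto.
  destruct (IH m'); auto.
Qed.

Lemma arg_position_not_nil n m (q : list nat) : repeat 0 n ++ repeat 1 m ++ [2] ++ q <> [].
Proof. intros E. apply (f_equal (@length nat)) in E. rewrite !length_app in E. simpl in E. lia. Qed.

Lemma annot_inv t p k : annot t p k -> exists k0 n y args, hred_n k0 t (hnf_of n y args) /\
  (p = [] /\ k = k0 \/ exists i a q, p = repeat 0 n ++ repeat 1 (length args - 1 - i) ++ [2] ++ q /\
     nth_error args i = Some a /\ annot a q k).
Proof.
  intros [t' k' n y args H|t' k' n y args i a q k0 H Hi Ha]; do 4 eexists; (split; [eassumption|]).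
  - now left.
  - right. now exists i, a, q.
Qed.

(** Head reduction is deterministic, so both derivations use the same hnf, and the 1s before the
    first 2 then determine the argument. *)
Lemma annot_fun t p k : annot t p k -> forall k', annot t p k' -> k = k'.
Proof.
  induction 1 as [t k n y args H|t k n y args i a q k0 H Hi Ha IH]; intros k' H';
    apply annot_inv in H'; destruct H' as [k1 [n1 [y1 [a1 [H1 C]]]]];
    destruct (hred_hnf_det _ _ _ _ _ _ _ _ _ H H1) as [-> [-> [-> ->]]];
    destruct C as [[E ->]|[i1 [b1 [q1 [E [Hi1 Hb1]]]]]].
  - reflexivity.
  - exfalso. symmetry in E. exact (arg_position_not_nil _ _ _ E).
  - exfalso. exact (arg_position_not_nil _ _ _ E).
  - apply app_inv_head, repeat_one_two_inj in E. destruct E as [E ->].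
    (* Truncated subtraction is injective here only because both indices are within range. *)
    assert (i < length a1) by (apply nth_error_Some; congruence).
    assert (i1 < length a1) by (apply nth_error_Some; congruence).
    assert (i1 = i) by lia. subst i1. rewrite Hi in Hi1. inversion Hi1; subst. auto.
Qed.

(* The [neutral] clause is for the induction: a head step that is not
   contracted must remain the head step inside an application. *)
Lemma par_hstep t t1 s : hstep t t1 -> par t s ->
  par t1 s \/ exists s1, hstep s s1 /\ par t1 s1 /\ (neutral t -> neutral s).
Proof.
  intros [A [B H]]. revert s. induction H; intros s Hp.
  - inversion Hp; subst.
    + inversion H1; subst. right. exists (subst 0 N' A'). repeat split.
      * do 2 eexists; constructor.
      * now apply par_inst.
      * intros _ P; discriminate.
    + left. now apply par_inst.
  - inversion Hp; subst. destruct (IHhstep_r _ H1) as [?|[s1 [[A1 [B1 Hs]] [? _]]]].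
    + left. now constructor.
    + right. exists (Lam s1). repeat split.
      * exists A1, B1. now constructor.
      * now constructor.
      * intros Hn. now destruct (Hn M).
  - inversion Hp; subst; [|now destruct (H A0)].
    destruct (IHhstep_r _ H3) as [?|[s1 [[A1 [B1 Hs]] [? Hne]]]].
    + left. now constructor.
    + right. exists (App s1 N'). repeat split.
      * exists A1, B1. constructor; [now apply Hne|assumption].
      * now constructor.
      * intros _ P; discriminate.
Qed.

Lemma par_apps l : forall h s, neutral h -> par (apps h l) s ->
  exists h' l', s = apps h' l' /\ par h h' /\ Forall2 par l l'.
Proof.
  induction l as [|a l IH]; intros h s Hn H.
  - exists s, []. auto.
  - simpl in H. destruct (IH (App h a) s) as [h' [l' [-> [Hh Hl]]]]; [intros P; discriminate|assumption|].
    inversion Hh; subst.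
    + exists M', (N' :: l'). auto.
    + now destruct (Hn A).
Qed.

Lemma par_hnf n y l s : par (hnf_of n y l) s -> exists l', s = hnf_of n y l' /\ Forall2 par l l'.
Proof.
  revert s. induction n as [|n IH]; intros s H.
  - destruct (par_apps l (Var y) s) as [h' [l' [-> [Hh Hl]]]]; [intros P; discriminate|assumption|].
    inversion Hh; subst. now exists l'.
  - inversion H; subst. destruct (IH _ H1) as [l' [-> Hl]]. now exists l'.
Qed.

(** A parallel step either contracts the current head redex or leaves it in head position, so it
    cannot lengthen the head reduction; at the hnf it acts inside the arguments. *)
Lemma par_hred k t n y l s : hred_n k t (hnf_of n y l) -> par t s ->
  exists k' l', k' <= k /\ hred_n k' s (hnf_of n y l') /\ Forall2 par l l'.
Proof.
  intros H. remember (hnf_of n y l) as u eqn:E. revert s E.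
  induction H as [t|k t t1 u H _ IH]; intros s -> Hp.
  - destruct (par_hnf _ _ _ _ Hp) as [l' [-> Hl]]. exists 0, l'. repeat split; auto. constructor.
  - destruct (par_hstep _ _ _ H Hp) as [Hp'|[s1 [Hs [Hp' _]]]].
    + destruct (IH _ eq_refl Hp') as [k' [l' [? [? ?]]]]. exists k', l'. auto.
    + destruct (IH _ eq_refl Hp') as [k' [l' [? [? ?]]]]. exists (S k'), l'. repeat split; auto.
      * lia.
      * econstructor; eassumption.
Qed.

Lemma Forall2_nth_error {X Y : Type} (R : X -> Y -> Prop) l l' : Forall2 R l l' ->
  forall i a, nth_error l i = Some a -> exists b, nth_error l' i = Some b /\ R a b.
Proof.
  induction 1 as [|x y l l' Hxy _ IH]; intros [|i] a E; simpl in *; try discriminate.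
  - inversion E; subst. eauto.
  - eauto.
Qed.

Lemma par_annot t p k : annot t p k -> forall s, par t s -> exists k', k' <= k /\ annot s p k'.
Proof.
  induction 1 as [t k n y args H|t k n y args i a q k0 H Hi Ha IH]; intros s Hp;
    destruct (par_hred _ _ _ _ _ _ H Hp) as [k' [l' [Hk [Hs Hl]]]].
  - exists k'. split; [assumption|]. econstructor; eassumption.
  - destruct (Forall2_nth_error _ _ _ Hl _ _ Hi) as [b [Hb Hab]].
    destruct (IH _ Hab) as [k1 [Hk1 Hb1]]. exists k1. split; [assumption|].
    rewrite (Forall2_length Hl). econstructor; eassumption.
Qed.

Lemma star_annot t s p k : beta_star t s -> annot t p k -> exists k', k' <= k /\ annot s p k'.
Proof.
  intros H. apply par_star_iff in H. revert k.
  induction H as [t|t t' s H _ IH]; intros k Ha; [eauto|].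
  destruct (par_annot _ _ _ Ha _ H) as [k1 [? H1]]. destruct (IH _ H1) as [k2 [? ?]].
  exists k2. split; [lia|assumption].
Qed.

(** * Linear approximants *)

(* In [RApp r l] the bag [l] lists the copies of the argument, and
   [RVar x i] stands for the i-th copy of the argument substituted for x. *)
Inductive rterm : Type :=
| RVar : nat -> nat -> rterm
| RLam : rterm -> rterm
| RApp : rterm -> list rterm -> rterm.

(** Bags nest terms inside lists, so the hypothesis on their members is supplied by an inner
    fixpoint. *)
Fixpoint rterm_ind' (P : rterm -> Prop)
  (HV : forall x i, P (RVar x i)) (HL : forall r, P r -> P (RLam r))
  (HA : forall r l, P r -> (forall b, In b l -> P b) -> P (RApp r l)) (r : rterm) : P r :=
  match r with
  | RVar x i => HV x i
  | RLam r => HL r (rterm_ind' P HV HL HA r)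
  | RApp r l => HA r l (rterm_ind' P HV HL HA r)
      ((fix F (l : list rterm) : forall b, In b l -> P b :=
          match l with
          | [] => fun b H => match H with end
          | c :: l => fun b H => match H with
                                 | or_introl E => eq_ind c P (rterm_ind' P HV HL HA c) b E
                                 | or_intror H => F l b H
                                 end
          end) l)
  end.

Fixpoint rren (xi : nat -> nat) (r : rterm) : rterm :=
  match r with
  | RVar x i => RVar (xi x) i
  | RLam a => RLam (rren (fun x => match x with 0 => 0 | S y => S (xi y) end) a)
  | RApp a l => RApp (rren xi a) (map (rren xi) l)
  end.

Definition rup (s : nat -> nat -> rterm) (x i : nat) : rterm :=
  match x with 0 => RVar 0 i | S y => rren S (s y i) end.

Fixpoint rsub (s : nat -> nat -> rterm) (r : rterm) : rterm :=
  match r with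
  | RVar x i => s x i
  | RLam a => RLam (rsub (rup s) a)
  | RApp a l => RApp (rsub s a) (map (rsub s) l)
  end.

(* The default is closed, so that [nth] commutes with substitution even out
   of range. *)
Definition rdefault : rterm := RLam (RVar 0 0).

Definition rinst (l : list rterm) (x i : nat) : rterm :=
  match x with 0 => nth i l rdefault | S y => RVar y i end.

Lemma rsub_ext r : forall s s', (forall x i, s x i = s' x i) -> rsub s r = rsub s' r.
Proof.
  induction r as [x i|a IH|a l IH IHl] using rterm_ind'; simpl; intros s s' E; f_equal; auto.
  - apply IH. intros [|x] i; simpl; congruence.
  - apply map_ext_in. auto.
Qed.

Lemma rren_as_rsub r : forall xi, rren xi r = rsub (fun x i => RVar (xi x) i) r.
Proof.
  induction r as [x i|a IH|a l IH IHl] using rterm_ind'; simpl; intros xi; f_equal; auto.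
  - rewrite IH. apply rsub_ext. intros [|x] i; reflexivity.
  - apply map_ext_in. auto.
Qed.

Lemma rsub_rren r : forall s xi, rsub s (rren xi r) = rsub (fun x i => s (xi x) i) r.
Proof.
  induction r as [x i|a IH|a l IH IHl] using rterm_ind'; simpl; intros s xi; f_equal; auto.
  - rewrite IH. apply rsub_ext. intros [|x] i; reflexivity.
  - rewrite map_map. apply map_ext_in. auto.
Qed.

Lemma rren_rren r xi zeta : rren zeta (rren xi r) = rren (fun x => zeta (xi x)) r.
Proof. now rewrite (rren_as_rsub (rren xi r)), rsub_rren, <- rren_as_rsub. Qed.

Lemma rren_rsub r : forall s xi, rren xi (rsub s r) = rsub (fun x i => rren xi (s x i)) r.
Proof.
  induction r as [x i|a IH|a l IH IHl] using rterm_ind'; simpl; intros s xi; f_equal; auto.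
  - rewrite IH. apply rsub_ext. intros [|x] i; simpl; [reflexivity|]. now rewrite !rren_rren.
  - rewrite map_map. apply map_ext_in. auto.
Qed.

Lemma rsub_rsub r : forall s s', rsub s' (rsub s r) = rsub (fun x i => rsub s' (s x i)) r.
Proof.
  induction r as [x i|a IH|a l IH IHl] using rterm_ind'; simpl; intros s s'; f_equal; auto.
  - rewrite IH. apply rsub_ext. intros [|x] i; simpl; [reflexivity|]. now rewrite rsub_rren, rren_rsub.
  - rewrite map_map. apply map_ext_in. auto.
Qed.

Lemma rsub_RVar r : forall s, (forall x i, s x i = RVar x i) -> rsub s r = r.
Proof.
  induction r as [x i|a IH|a l IH IHl] using rterm_ind'; simpl; intros s E; f_equal; auto.
  - apply IH. intros [|x] i; simpl; [reflexivity|]. now rewrite E.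
  - rewrite <- (map_id l) at 2. apply map_ext_in. auto.
Qed.

Lemma rsub_rinst a l s : rsub s (rsub (rinst l) a) = rsub (rinst (map (rsub s) l)) (rsub (rup s) a).
Proof.
  rewrite !rsub_rsub. apply rsub_ext. intros [|x] i; simpl.
  - change rdefault with (rsub s rdefault) at 2. now rewrite map_nth.
  - rewrite rsub_rren. symmetry. now apply rsub_RVar.
Qed.

(* Free occurrences, as pairs (variable, index), from left to right. *)
Definition down (F : list (nat * nat)) : list (nat * nat) :=
  flat_map (fun o => match o with (0, _) => [] | (S x, i) => [(x, i)] end) F.

Definition idx0 (F : list (nat * nat)) : list nat :=
  flat_map (fun o => match o with (0, i) => [i] | (S _, _) => [] end) F.

Fixpoint fv (r : rterm) : list (nat * nat) :=
  match r with
  | RVar x i => [(x, i)]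
  | RLam a => down (fv a)
  | RApp a l => fv a ++ flat_map fv l
  end.

Lemma flat_map_flat_map {X Y Z : Type} (f : Y -> list Z) (g : X -> list Y) l :
  flat_map f (flat_map g l) = flat_map (fun x => flat_map f (g x)) l.
Proof. induction l as [|x l IH]; simpl; [reflexivity|]. now rewrite flat_map_app, IH. Qed.

Lemma flat_map_ext_in {X Y : Type} (f g : X -> list Y) l :
  (forall x, In x l -> f x = g x) -> flat_map f l = flat_map g l.
Proof.
  induction l as [|x l IH]; simpl; intros E; [reflexivity|].
  rewrite E by auto. f_equal. auto.
Qed.

Lemma flat_map_map {X Y Z : Type} (f : Y -> list Z) (g : X -> Y) l :
  flat_map f (map g l) = flat_map (fun x => f (g x)) l.
Proof. induction l as [|x l IH]; simpl; congruence. Qed.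

Lemma fv_rren r : forall xi, fv (rren xi r) = flat_map (fun o => [(xi (fst o), snd o)]) (fv r).
Proof.
  induction r as [x i|a IH|a l IH IHl] using rterm_ind'; simpl; intros xi.
  - reflexivity.
  - rewrite IH. unfold down. rewrite !flat_map_flat_map. apply flat_map_ext_in.
    intros [[|x] i] _; reflexivity.
  - rewrite flat_map_app, IH. f_equal.
    rewrite flat_map_map, flat_map_flat_map. apply flat_map_ext_in. auto.
Qed.

Lemma down_rren_S r : down (fv (rren S r)) = fv r.
Proof.
  rewrite fv_rren. unfold down. rewrite flat_map_flat_map.
  induction (fv r) as [|[x i] F IH]; simpl in *; congruence.
Qed.

Lemma idx0_rren_S r : idx0 (fv (rren S r)) = [].
Proof.
  rewrite fv_rren. unfold idx0. rewrite flat_map_flat_map.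
  induction (fv r) as [|[x i] F IH]; simpl in *; congruence.
Qed.

Lemma fv_rsub r : forall s, fv (rsub s r) = flat_map (fun o => fv (s (fst o) (snd o))) (fv r).
Proof.
  induction r as [x i|a IH|a l IH IHl] using rterm_ind'; simpl; intros s.
  - now rewrite app_nil_r.
  - rewrite IH. unfold down. rewrite !flat_map_flat_map. apply flat_map_ext_in.
    intros [[|x] i] _; simpl; [reflexivity|]. rewrite app_nil_r. apply down_rren_S.
  - rewrite flat_map_app, IH. f_equal.
    rewrite flat_map_map, flat_map_flat_map. apply flat_map_ext_in. auto.
Qed.

Lemma idx0_rsub_rup r s : idx0 (fv (rsub (rup s) r)) = idx0 (fv r).
Proof.
  rewrite fv_rsub. unfold idx0 at 1. rewrite flat_map_flat_map. apply flat_map_ext_in.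
  intros [[|x] i] _; simpl; [reflexivity|]. apply idx0_rren_S.
Qed.

Lemma in_down x i F : In (x, i) (down F) <-> In (S x, i) F.
Proof.
  unfold down. rewrite in_flat_map. split.
  - intros [[[|y] j] [H H']]; simpl in H'; [contradiction|]. destruct H' as [E|[]]. congruence.
  - intros H. exists (S x, i). simpl. auto.
Qed.

Lemma in_idx0 i F : In i (idx0 F) <-> In (0, i) F.
Proof.
  unfold idx0. rewrite in_flat_map. split.
  - intros [[[|y] j] [H H']]; simpl in H'; [|contradiction]. destruct H' as [E|[]]. congruence.
  - intros H. exists (0, i). simpl. auto.
Qed.

(** Isolates the occurrences of variable 0, the only ones that [rinst] replaces by copies. *)
Lemma split_occurrences (f : nat * nat -> list (nat * nat)) F :
  Permutation (flat_map f F)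
    (flat_map (fun o => f (S (fst o), snd o)) (down F) ++ flat_map (fun i => f (0, i)) (idx0 F)).
Proof.
  unfold down, idx0.
  induction F as [|[[|x] i] F IH]; simpl.
  - constructor.
  - rewrite IH. apply Permutation_app_swap_app.
  - rewrite IH, app_assoc. reflexivity.
Qed.

(** * Abstraction count and linear bags *)

Fixpoint lamc (r : rterm) : nat :=
  match r with
  | RVar _ _ => 0
  | RLam a => S (lamc a)
  | RApp a l => lamc a + list_sum (map lamc l)
  end.

Definition lamc_at (s : nat -> nat -> rterm) (F : list (nat * nat)) : nat :=
  list_sum (map (fun o => lamc (s (fst o) (snd o))) F).

Lemma lamc_at_app s F G : lamc_at s (F ++ G) = lamc_at s F + lamc_at s G.
Proof. unfold lamc_at. now rewrite map_app, list_sum_app. Qed.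

Lemma lamc_rren r : forall xi, lamc (rren xi r) = lamc r.
Proof.
  induction r as [x i|a IH|a l IH IHl] using rterm_ind'; simpl; intros xi; auto.
  rewrite IH, map_map. do 2 f_equal. apply map_ext_in. auto.
Qed.

Lemma lamc_at_rup s F : lamc_at (rup s) F = lamc_at s (down F).
Proof.
  unfold lamc_at. induction F as [|[[|x] i] F IH]; simpl; auto. now rewrite IH, lamc_rren.
Qed.

Lemma lamc_rsub r : forall s, lamc (rsub s r) = lamc r + lamc_at s (fv r).
Proof.
  induction r as [x i|a IH|a l IH IHl] using rterm_ind'; simpl; intros s.
  - unfold lamc_at. simpl. lia.
  - now rewrite IH, lamc_at_rup.
  - rewrite lamc_at_app, IH.
    assert (list_sum (map lamc (map (rsub s) l)) = list_sum (map lamc l) + lamc_at s (flat_map fv l)); [|lia].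
    induction l as [|b l IH2]; simpl; [reflexivity|].
    rewrite lamc_at_app, IHl by (simpl; auto). rewrite IH2 by (intros; apply IHl; simpl; auto). lia.
Qed.

(** Each index below the length of the bag labels exactly one occurrence of variable 0, and no other
    index does: contraction neither duplicates nor discards a copy. *)
Definition linear (a : rterm) (l : list rterm) : Prop :=
  Permutation (idx0 (fv a)) (seq 0 (length l)).

Lemma linear_index a l i : linear a l -> In (0, i) (fv a) <-> i < length l.
Proof.
  intros H. rewrite <- in_idx0, H, in_seq. lia.
Qed.

Lemma lamc_at_rinst l F : lamc_at (rinst l) F =
  list_sum (map (fun i => lamc (nth i l rdefault)) (idx0 F)).
Proof. unfold lamc_at. induction F as [|[[|x] i] F IH]; simpl; auto. Qed.

Lemma map_nth_seq {X Y : Type} (f : X -> Y) l d :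
  map (fun i => f (nth i l d)) (seq 0 (length l)) = map f l.
Proof.
  induction l as [|x l IH]; [reflexivity|]. cbn [length seq map]. f_equal.
  rewrite <- seq_shift, map_map. exact IH.
Qed.

Lemma flat_map_nth_seq {X Y : Type} (f : X -> list Y) l d :
  flat_map (fun i => f (nth i l d)) (seq 0 (length l)) = flat_map f l.
Proof. rewrite !flat_map_concat_map. f_equal. apply map_nth_seq. Qed.

(** Every copy is inserted exactly once, so contracting a linear redex loses only the abstraction of
    the redex itself. *)
Lemma lamc_rinst a l : linear a l -> lamc (rsub (rinst l) a) = lamc a + list_sum (map lamc l).
Proof.
  intros H. rewrite lamc_rsub, lamc_at_rinst. f_equal.
  rewrite (Permutation_list_sum (Permutation_map _ H)). f_equal. apply map_nth_seq.
Qed.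

Lemma fv_rinst a l : linear a l ->
  Permutation (fv (rsub (rinst l) a)) (down (fv a) ++ flat_map fv l).
Proof.
  intros H. rewrite fv_rsub, split_occurrences. apply Permutation_app.
  - simpl. induction (down (fv a)) as [|[x i] F IH]; simpl; auto.
  - simpl. rewrite (Permutation_flat_map _ H). now rewrite flat_map_nth_seq.
Qed.

(** * Approximation and the thrifty invariant *)

Inductive apx : term -> rterm -> Prop :=
| apx_var x i : apx (Var x) (RVar x i)
| apx_lam A a : apx A a -> apx (Lam A) (RLam a)
| apx_app M N r l : apx M r -> (forall b, In b l -> apx N b) -> apx (App M N) (RApp r l).

Lemma apx_rren t r : apx t r -> forall xi, apx (ren xi t) (rren xi r).
Proof.
  induction 1 as [| |M N r l _ IH _ IHl]; simpl; intros xi; constructor; auto.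
  intros b Hb. apply in_map_iff in Hb. destruct Hb as [c [<- Hc]]. auto.
Qed.

Lemma apx_rsub t r : apx t r -> forall s rs, (forall x i, In (x, i) (fv r) -> apx (s x) (rs x i)) ->
  apx (sub s t) (rsub rs r).
Proof.
  induction 1 as [x i|A a _ IH|M N r l _ IH _ IHl]; simpl; intros s rs H.
  - apply H. auto.
  - constructor. apply IH. intros [|x] i Hx; simpl; [constructor|].
    apply apx_rren, H. now apply in_down.
  - constructor.
    + apply IH. intros x i Hx. apply H, in_or_app. auto.
    + intros b Hb. apply in_map_iff in Hb. destruct Hb as [c [<- Hc]]. apply IHl; auto.
      intros x i Hx. apply H, in_or_app. right. apply in_flat_map. eauto.
Qed.

Lemma apx_rinst A a B l : apx A a -> (forall b, In b l -> apx B b) -> linear a l ->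
  apx (subst 0 B A) (rsub (rinst l) a).
Proof.
  intros HA HB HL. rewrite subst_inst. apply apx_rsub; auto.
  intros [|x] i Hx; simpl; [|constructor].
  apply HB, nth_In. now apply (linear_index _ _ _ HL).
Qed.

(** An argument that can still be reduced has at most one copy, and every redex already visible
    consumes its bag exactly. *)
Inductive thrifty : term -> rterm -> Prop :=
| thrifty_var x i : thrifty (Var x) (RVar x i)
| thrifty_lam A a : thrifty A a -> thrifty (Lam A) (RLam a)
| thrifty_app M N r l : thrifty M r -> (forall b, In b l -> thrifty N b) ->
    (beta_nf N \/ length l <= 1) -> (forall a, r = RLam a -> linear a l) ->
    thrifty (App M N) (RApp r l).

Lemma thrifty_apx t r : thrifty t r -> apx t r.
Proof. induction 1; constructor; auto. Qed.

Lemma beta_ren t s : beta t s -> forall xi, beta (ren xi t) (ren xi s).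
Proof.
  induction 1; simpl; intros xi; try (constructor; auto; fail).
  rewrite ren_subst. constructor.
Qed.

Lemma beta_sub t u : beta t u -> forall s, beta (sub s t) (sub s u).
Proof.
  induction 1; simpl; intros s; try (constructor; auto; fail).
  rewrite sub_subst. constructor.
Qed.

Lemma nf_sub_inv t s : beta_nf (sub s t) -> beta_nf t.
Proof. intros H u Hu. exact (H _ (beta_sub _ _ Hu s)). Qed.

Lemma nf_app_inv M N : beta_nf (App M N) -> beta_nf M /\ beta_nf N.
Proof. intros H. split; intros u Hu; eapply H; constructor; eassumption. Qed.

Lemma nf_lam_inv A : beta_nf (Lam A) -> beta_nf A.
Proof. intros H u Hu; eapply H; constructor; eassumption. Qed.

Lemma linear_rsub_inv a l s : linear (rsub (rup s) a) (map (rsub s) l) -> linear a l.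
Proof. unfold linear. now rewrite idx0_rsub_rup, length_map. Qed.

(** Substitution reflects all the conditions: instances of redexes are redexes, so [N] is normal
    when its instance is; bags keep their length; and a substitution under a binder leaves the
    occurrences of variable 0 alone. *)
Lemma thrifty_rsub_inv t r : apx t r -> forall s rs, thrifty (sub s t) (rsub rs r) -> thrifty t r.
Proof.
  induction 1 as [x i|A a _ IH|M N r l Hr IH Hl IHl]; simpl; intros s rs H.
  - constructor.
  - inversion H; subst. constructor. eauto.
  - inversion H as [| |M0 N0 r0 l0 H1 H2 H3 H4]; subst. constructor.
    + eauto.
    + intros b Hb. apply IHl with s rs; auto. apply H2. now apply in_map.
    + rewrite length_map in H3. destruct H3 as [H3|H3]; [left|now right].
      eapply nf_sub_inv; eassumption.
    + intros a ->. eapply linear_rsub_inv. now apply H4.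
Qed.

Lemma apx_rren_inv t : forall xi r, apx (ren xi t) r -> exists r0, r = rren xi r0 /\ apx t r0.
Proof.
  induction t as [x|A IH|M IH N IH']; simpl; intros xi r H; inversion H; subst.
  - exists (RVar x i). split; [reflexivity|constructor].
  - destruct (IH _ _ H1) as [a0 [-> ?]]. exists (RLam a0). split; [reflexivity|now constructor].
  - destruct (IH _ _ H2) as [r1 [-> ?]].
    assert (exists l1, l = map (rren xi) l1 /\ forall b, In b l1 -> apx N b) as [l1 [-> ?]].
    { clear H2 H. induction l as [|b l IHl].
      - exists []. split; [reflexivity|intros b []].
      - destruct IHl as [l1 [-> Hl1]]; [intros; apply H4; now right|].
        destruct (IH' xi b) as [b1 [-> Hb1]]; [apply H4; now left|].
        exists (b1 :: l1). split; [reflexivity|]. intros c [<-|Hc]; auto. }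
    exists (RApp r1 l1). split; [reflexivity|now constructor].
Qed.

Lemma thrifty_rren_inv t xi r : thrifty (ren xi t) (rren xi r) -> apx t r -> thrifty t r.
Proof. intros H Ha. rewrite ren_as_sub, rren_as_rsub in H. eapply thrifty_rsub_inv; eassumption. Qed.

(** What is put at a free occurrence is a part of the instance, up to the renaming caused by the
    binders crossed, and thriftiness passes to parts. *)
Lemma thrifty_image t r : apx t r -> forall s rs x i, In (x, i) (fv r) -> apx (s x) (rs x i) ->
  thrifty (sub s t) (rsub rs r) -> thrifty (s x) (rs x i).
Proof.
  induction 1 as [y j|A a _ IH|M N r l Hr IH Hl IHl]; simpl; intros s rs x i Hx Ha H.
  - destruct Hx as [E|[]]. inversion E; subst. assumption.
  - inversion H; subst. apply in_down in Hx.
    specialize (IH (up s) (rup rs) (S x) i Hx). simpl in IH.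
    eapply thrifty_rren_inv; [apply IH; [now apply apx_rren|assumption]|assumption].
  - inversion H as [| |M0 N0 r0 l0 H1 H2 H3 H4]; subst. apply in_app_or in Hx. destruct Hx as [Hx|Hx].
    + eauto.
    + apply in_flat_map in Hx. destruct Hx as [b [Hb Hx]]. eapply IHl; eauto.
      apply H2. now apply in_map.
Qed.

(** A head step carried out simultaneously on a term and its approximant. The side conditions of the
    redex rule are what [thrifty] demands of this redex before the step. *)
Inductive rhstep : term -> rterm -> term -> rterm -> Prop :=
| rhstep_redex A B a l : apx A a -> (forall b, In b l -> apx B b) -> linear a l ->
    (beta_nf B \/ length l <= 1) ->
    rhstep (App (Lam A) B) (RApp (RLam a) l) (subst 0 B A) (rsub (rinst l) a)
| rhstep_lam M M' r r' : rhstep M r M' r' -> rhstep (Lam M) (RLam r) (Lam M') (RLam r')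
| rhstep_app M M' N r r' l : neutral M -> rhstep M r M' r' -> (forall b, In b l -> apx N b) ->
    rhstep (App M N) (RApp r l) (App M' N) (RApp r' l).

Lemma rhstep_hstep t r t' r' : rhstep t r t' r' -> hstep t t'.
Proof.
  induction 1 as [A B a l|M M' r r' _ [A [B IH]]|M M' N r r' l Hn _ [A [B IH]]];
    do 2 eexists; constructor; eassumption.
Qed.

Lemma rhstep_apx t r t' r' : rhstep t r t' r' -> apx t r.
Proof. induction 1; repeat constructor; auto. Qed.

Lemma rhstep_lamc t r t' r' : rhstep t r t' r' -> lamc r = S (lamc r').
Proof. induction 1; simpl; [rewrite lamc_rinst by assumption| |]; lia. Qed.

(** Body and copies are recovered from the contractum: the body because substitution reflects
    thriftiness, a copy because linearity provides an occurrence where it is inserted. *)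
Lemma rhstep_thrifty t r t' r' : rhstep t r t' r' -> thrifty t' r' -> thrifty t r.
Proof.
  induction 1 as [A B a l Ha Hl HL Hs|M M' r r' _ IH|M M' N r r' l Hn Hh IH Hl]; intros H.
  - rewrite subst_inst in H. constructor; auto.
    + constructor. eapply thrifty_rsub_inv; eassumption.
    + intros b Hb. destruct (In_nth _ _ rdefault Hb) as [i [Hi <-]].
      apply (linear_index _ _ _ HL) in Hi.
      change B with (inst B 0). change (nth i l rdefault) with (rinst l 0 i).
      apply (thrifty_image A a Ha); auto.
    + intros a' E. now inversion E; subst.
  - inversion H; subst. constructor. auto.
  - inversion H; subst. constructor; auto.
    intros a ->. apply rhstep_apx in Hh. inversion Hh; subst. now destruct (Hn A).
Qed.

(** * Reduction of approximants *)

(** A parallel step of a term together with its approximant. The copies in a bag may follow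
    different derivations, but all towards the same [N']; an empty bag still records that step. *)
Inductive rpar : term -> rterm -> term -> rterm -> Prop :=
| rpar_var x i : rpar (Var x) (RVar x i) (Var x) (RVar x i)
| rpar_lam A a A' a' : rpar A a A' a' -> rpar (Lam A) (RLam a) (Lam A') (RLam a')
| rpar_app M r M' r' N l N' l' : rpar M r M' r' -> rpars N l N' l' ->
    rpar (App M N) (RApp r l) (App M' N') (RApp r' l')
| rpar_beta A a A' a' B l B' l' : rpar A a A' a' -> rpars B l B' l' ->
    rpar (App (Lam A) B) (RApp (RLam a) l) (subst 0 B' A') (rsub (rinst l') a')
with rpars : term -> list rterm -> term -> list rterm -> Prop :=
| rpars_nil N N' : par N N' -> rpars N [] N' []
| rpars_cons N b l N' b' l' : rpar N b N' b' -> rpars N l N' l' ->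
    rpars N (b :: l) N' (b' :: l').

Scheme rpar_mut := Minimality for rpar Sort Prop
  with rpars_mut := Minimality for rpars Sort Prop.
Combined Scheme rpar_rpars_ind from rpar_mut, rpars_mut.

Lemma rpar_par :
  (forall t r t' r', rpar t r t' r' -> par t t') /\
  (forall t l t' l', rpars t l t' l' -> par t t').
Proof. apply rpar_rpars_ind; intros; auto; constructor; auto. Qed.

Lemma rpars_length N l N' l' : rpars N l N' l' -> length l = length l'.
Proof. induction 1; simpl; auto. Qed.

Lemma rpars_nth N l N' l' : rpars N l N' l' -> forall i d, i < length l ->
  rpar N (nth i l d) N' (nth i l' d).
Proof.
  induction 1; intros [|i] d Hi; simpl in *; try lia; auto. apply IHrpars. lia.
Qed.

Lemma rpar_refl t r : apx t r -> rpar t r t r.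
Proof.
  induction 1 as [| |M N r l _ IH _ IHl]; constructor; auto.
  clear IH. induction l as [|b l IH]; constructor.
  - apply par_refl.
  - apply IHl. now left.
  - apply IH. intros; apply IHl. now right.
Qed.

Lemma rpars_refl N l : (forall b, In b l -> apx N b) -> rpars N l N l.
Proof.
  induction l as [|b l IH]; intros H; constructor.
  - apply par_refl.
  - apply rpar_refl, H. now left.
  - apply IH. intros; apply H. now right.
Qed.

Lemma rren_rinst a l xi : rren xi (rsub (rinst l) a) =
  rsub (rinst (map (rren xi) l)) (rren (fun x => match x with 0 => 0 | S y => S (xi y) end) a).
Proof.
  rewrite rren_rsub, rsub_rren. apply rsub_ext. intros [|x] i; simpl; [|reflexivity].
  change rdefault with (rren xi rdefault) at 2. now rewrite map_nth.
Qed.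

Lemma rpar_rren :
  (forall t r t' r', rpar t r t' r' -> forall xi, rpar (ren xi t) (rren xi r) (ren xi t') (rren xi r')) /\
  (forall t l t' l', rpars t l t' l' -> forall xi,
     rpars (ren xi t) (map (rren xi) l) (ren xi t') (map (rren xi) l')).
Proof.
  apply rpar_rpars_ind; simpl; intros; try (constructor; auto; fail).
  - rewrite ren_subst, rren_rinst. constructor; auto.
  - constructor. now apply par_ren.
Qed.

(** [s] and [s'] are related everywhere, because an argument with an empty bag reduces although no
    occurrence records it; [rs] and [rs'] only at free occurrences, because [rinst] reads the bag
    only at indices within its length. *)
Lemma rpar_rsub :
  (forall t r t' r', rpar t r t' r' -> forall s rs s' rs', (forall x, par (s x) (s' x)) ->
     (forall x i, In (x, i) (fv r) -> rpar (s x) (rs x i) (s' x) (rs' x i)) ->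
     rpar (sub s t) (rsub rs r) (sub s' t') (rsub rs' r')) /\
  (forall t l t' l', rpars t l t' l' -> forall s rs s' rs', (forall x, par (s x) (s' x)) ->
     (forall x i, In (x, i) (flat_map fv l) -> rpar (s x) (rs x i) (s' x) (rs' x i)) ->
     rpars (sub s t) (map (rsub rs) l) (sub s' t') (map (rsub rs') l')).
Proof.
  assert (U : forall s s', (forall x, par (s x) (s' x)) -> forall x, par (up s x) (up s' x)).
  { intros s s' E [|x]; simpl; [constructor|]. now apply par_ren. }
  assert (V : forall a (s : nat -> term) (rs : nat -> nat -> rterm) s' rs',
    (forall x i, In (x, i) (down (fv a)) -> rpar (s x) (rs x i) (s' x) (rs' x i)) ->
    forall x i, In (x, i) (fv a) -> rpar (up s x) (rup rs x i) (up s' x) (rup rs' x i)).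
  { intros a s rs s' rs' H [|x] i Hx; simpl; [constructor|].
    apply (proj1 rpar_rren), H. now apply in_down. }
  apply rpar_rpars_ind; simpl.
  - intros x i s rs s' rs' _ H. apply H. auto.
  - intros A a A' a' _ IH s rs s' rs' Hs H. constructor. apply IH; eauto.
  - intros M r M' r' N l N' l' _ IH _ IHl s rs s' rs' Hs H. constructor.
    + apply IH; auto. intros; apply H, in_or_app; auto.
    + apply IHl; auto. intros; apply H, in_or_app; auto.
  - intros A a A' a' B l B' l' _ IH _ IHl s rs s' rs' Hs H.
    rewrite sub_subst, rsub_rinst. constructor.
    + apply IH; auto. apply V. intros; apply H, in_or_app; auto.
    + apply IHl; auto. intros; apply H, in_or_app; auto.
  - intros N N' Hp s rs s' rs' Hs _. constructor. now apply par_sub.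
  - intros N b l N' b' l' _ IH _ IHl s rs s' rs' Hs H. constructor.
    + apply IH; auto. intros; apply H, in_or_app; auto.
    + apply IHl; auto. intros; apply H, in_or_app; auto.
Qed.

Lemma rpar_rinst A a A' a' B l B' l' : rpar A a A' a' -> rpars B l B' l' -> linear a l ->
  rpar (subst 0 B A) (rsub (rinst l) a) (subst 0 B' A') (rsub (rinst l') a').
Proof.
  intros HA HB HL. rewrite !subst_inst. apply (proj1 rpar_rsub); auto.
  - intros [|x]; simpl; [|constructor]. exact (proj2 rpar_par _ _ _ _ HB).
  - intros [|x] i Hx; simpl; [|constructor]. eapply rpars_nth; [eassumption|].
    now apply (linear_index _ _ _ HL).
Qed.

Lemma linear_perm a a' (l l' : list rterm) : Permutation (fv a') (fv a) -> length l = length l' ->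
  linear a l -> linear a' l'.
Proof.
  unfold linear. intros P <- H. rewrite <- H. now apply Permutation_flat_map.
Qed.

(** Linear contraction neither duplicates nor erases an occurrence. Free occurrences are only
    permuted, which keeps enclosing redexes linear. *)
Lemma rpar_linear :
  (forall t r t' r', rpar t r t' r' -> thrifty t r -> Permutation (fv r') (fv r) /\ apx t' r') /\
  (forall t l t' l', rpars t l t' l' -> (forall b, In b l -> thrifty t b) ->
     Permutation (flat_map fv l') (flat_map fv l) /\ forall b, In b l' -> apx t' b).
Proof.
  apply rpar_rpars_ind; simpl.
  - intros x i _. split; [reflexivity|constructor].
  - intros A a A' a' _ IH H. inversion H; subst. destruct IH as [P Ha]; [assumption|].
    split; [now apply Permutation_flat_map|now constructor].
  - intros M r M' r' N l N' l' _ IH _ IHl H. inversion H; subst.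
    destruct IH as [P Ha]; [assumption|]. destruct IHl as [Pl Hl]; [assumption|].
    split; [now apply Permutation_app|now constructor].
  - intros A a A' a' B l B' l' _ IH Hl IHl H.
    inversion H as [| |M0 N0 r0 l0 H1 H2 H3 H4]; subst. inversion H1; subst.
    destruct IH as [P Ha]; [assumption|]. destruct IHl as [Pl Hb]; [assumption|].
    assert (HL : linear a' l').
    { eapply linear_perm; [eassumption|eapply rpars_length; eassumption|now apply H4]. }
    split; [|now apply apx_rinst].
    rewrite (fv_rinst _ _ HL). apply Permutation_app; [|assumption]. now apply Permutation_flat_map.
  - intros N N' _ _. split; [reflexivity|intros b []].
  - intros N b l N' b' l' _ IH _ IHl H.
    destruct IH as [P Ha]; [auto|]. destruct IHl as [Pl Hb]; [auto|].
    split; [now apply Permutation_app|]. intros c [<-|Hc]; auto.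
Qed.

Lemma par_nf t s : par t s -> beta_nf t -> s = t.
Proof.
  induction 1; intros Hn.
  - reflexivity.
  - f_equal. apply IHpar. now apply nf_lam_inv.
  - apply nf_app_inv in Hn. destruct Hn. f_equal; auto.
  - exfalso. eapply Hn. constructor.
Qed.

Lemma rpar_rhstep t r t1 r1 : rhstep t r t1 r1 -> thrifty t r -> forall s r', rpar t r s r' ->
  rpar t1 r1 s r' \/
  exists s1 r1', rhstep s r' s1 r1' /\ rpar t1 r1 s1 r1' /\ (neutral t -> neutral s).
Proof.
  induction 1 as [A B a l Ha Hl HL Hs|M M1 r r1 _ IH|M M1 N r r1 l Hn Hh IH Hl];
    intros Hst s r' Hp.
  - inversion Hst as [| |M0 N0 r0 l0 H1 H2 H3 H4]; subst. inversion H1; subst.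
    inversion Hp as [| |M0 r0 M' r'' N0 l0 N' l' Hf Hb|A0 a0 A' a' B0 l0 B' l' Hf Hb]; subst.
    + inversion Hf as [|A0 a0 A' a' Hf' | |]; subst. right.
      destruct (proj1 rpar_linear _ _ _ _ Hf') as [P Ha']; [assumption|].
      destruct (proj2 rpar_linear _ _ _ _ Hb) as [_ Hb']; [assumption|].
      pose proof (rpars_length _ _ _ _ Hb) as E.
      exists (subst 0 N' A'), (rsub (rinst l') a'). repeat split.
      * constructor; auto.
        -- eapply linear_perm; eassumption.
        -- destruct Hs as [Hs|Hs]; [left|right; lia].
           now rewrite (par_nf _ _ (proj2 rpar_par _ _ _ _ Hb) Hs).
      * now apply rpar_rinst.
      * intros _ P'; discriminate.
    + left. now apply rpar_rinst.
  - inversion Hst; subst. inversion Hp as [|A0 a0 A' a' Hf| |]; subst.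
    destruct (IH ltac:(assumption) _ _ Hf) as [?|[s1 [r1' [? [? _]]]]].
    + left. now constructor.
    + right. exists (Lam s1), (RLam r1'). repeat split; try (constructor; assumption).
      intros E. now destruct (E M).
  - inversion Hst as [| |M0 N0 r0 l0 H1 H2 H3 H4]; subst.
    inversion Hp as [| |M0 r0 M' r'' N0 l0 N' l' Hf Hb|A0 a0 A' a' B0 l0 B' l' Hf Hb]; subst;
      [|now destruct (Hn A0)].
    destruct (IH H1 _ _ Hf) as [?|[s1 [r1' [? [? Hne]]]]].
    + left. now constructor.
    + right. exists (App s1 N'), (RApp r1' l'). repeat split.
      * constructor; auto. exact (proj2 (proj2 rpar_linear _ _ _ _ Hb H2)).
      * now constructor.
      * intros _ P'; discriminate.
Qed.

(** The contracted redex has at most one copy in [r], so lifting the step to [r] removes at most one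
    abstraction. *)
Lemma thrifty_beta t s : beta t s -> forall r, thrifty t r ->
  exists r', rpar t r s r' /\ lamc r <= S (lamc r').
Proof.
  induction 1 as [A B|M M' _ IH|M M' N _ IH|M N N' Hb IH]; intros r H.
  - inversion H as [| |M0 N0 r0 l0 H1 H2 H3 H4]; subst. inversion H1; subst.
    exists (rsub (rinst l0) a). split.
    + constructor; [now apply rpar_refl, thrifty_apx|]. apply rpars_refl. intros; now apply thrifty_apx; auto.
    + simpl. rewrite lamc_rinst by auto. lia.
  - inversion H; subst. destruct (IH _ H1) as [a' [? ?]]. exists (RLam a'). split; [now constructor|].
    simpl. lia.
  - inversion H as [| |M0 N0 r0 l0 H1 H2 H3 H4]; subst. destruct (IH _ H1) as [r' [? ?]].
    exists (RApp r' l0). split.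
    + constructor; [assumption|]. apply rpars_refl. intros; now apply thrifty_apx; auto.
    + simpl. lia.
  - inversion H as [| |M0 N0 r0 l0 H1 H2 H3 H4]; subst.
    (* The argument contains a redex, so it is not normal and its bag holds at most one copy. With
       an empty bag the redex is not represented and nothing is lost. *)
    destruct H3 as [H3|H3]; [exfalso; eapply H3; eassumption|].
    destruct l0 as [|b [|c l0]]; [| |simpl in H3; lia].
    + exists (RApp r0 []). split; [|simpl; lia].
      constructor; [now apply rpar_refl, thrifty_apx|]. constructor. now apply par_of_beta.
    + destruct (IH b) as [b' [? ?]]; [apply H2; now left|].
      exists (RApp r0 [b']). split; [|simpl; lia].
      constructor; [now apply rpar_refl, thrifty_apx|].
      constructor; [assumption|]. constructor. now apply par_of_beta.
Qed.

(** * Explorations of the clocked Böhm tree *)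

Definition entry : Type := list nat * nat * nat.

Definition shift (p : list nat) (e : entry) : entry :=
  let '(q, n, k) := e in (p ++ q, n, k).

Fixpoint rlams (n : nat) (r : rterm) : rterm :=
  match n with 0 => r | S m => RLam (rlams m r) end.

Definition rhnf (n y i : nat) (bags : list (list rterm)) : rterm :=
  rlams n (fold_left RApp bags (RVar y i)).

(* [good t r n k w]: evaluating t along its approximant r explores a finite
   part of cBT(t); its root has n abstractions and annotation k, and w lists
   (position, abstractions, annotation) for the other explored nodes. *)
Inductive good : term -> rterm -> nat -> nat -> list entry -> Prop :=
| good_hnf n y i args bags w : goods args bags w ->
    good (hnf_of n y args) (rhnf n y i bags) n 0 (map (shift (repeat 0 n)) w)
| good_step t r t' r' n k w : rhstep t r t' r' -> good t' r' n k w -> good t r n (S k) w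
with goods : list term -> list (list rterm) -> list entry -> Prop :=
| goods_nil : goods [] [] []
| goods_skip a args bags w : goods args bags w -> goods (a :: args) ([] :: bags) w
| goods_cons a args b bags n k wa w : good a b n k wa -> goods args bags w ->
    goods (a :: args) ([b] :: bags)
      (map (shift (repeat 1 (length args) ++ [2])) (([], n, k) :: wa) ++ w).

Scheme good_mut := Minimality for good Sort Prop
  with goods_mut := Minimality for goods Sort Prop.
Combined Scheme good_goods_ind from good_mut, goods_mut.

Inductive thriftys : list term -> list (list rterm) -> Prop :=
| thriftys_nil : thriftys [] []
| thriftys_cons a args l bags : (forall b, In b l -> thrifty a b) -> length l <= 1 -> thriftys args bags ->
    thriftys (a :: args) (l :: bags).

Lemma thriftys_apps args bags : thriftys args bags -> forall h g, thrifty h g -> neutral h ->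
  thrifty (apps h args) (fold_left RApp bags g).
Proof.
  induction 1 as [|a args l bags Hl Hs _ IH]; intros h g Hg Hn; simpl; [assumption|].
  apply IH; [|intros P; discriminate]. constructor; auto.
  intros b ->. inversion Hg; subst. now destruct (Hn A).
Qed.

Lemma thrifty_lams n t r : thrifty t r -> thrifty (lams n t) (rlams n r).
Proof. induction n; simpl; [auto|]. intros; constructor; auto. Qed.

(** An explored hnf has bags of at most one copy and is therefore thrifty; [rhstep_thrifty] carries
    this back to the start of the evaluation. *)
Lemma good_thrifty :
  (forall t r n k w, good t r n k w -> thrifty t r) /\
  (forall args bags w, goods args bags w -> thriftys args bags).
Proof.
  apply good_goods_ind.
  - intros n y i args bags w _ H. apply thrifty_lams, thriftys_apps; auto;
      [constructor|intros P; discriminate].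
  - intros t r t' r' n k w H _ IH. eapply rhstep_thrifty; eassumption.
  - constructor.
  - intros a args bags w _ IH. constructor; auto. intros b [].
  - intros a args b bags n k wa w _ IH _ IHs. constructor; auto. intros c [<-|[]]. assumption.
Qed.

Definition wsum (w : list entry) : nat := list_sum (map (fun e => snd (fst e) + snd e) w).

Lemma wsum_shift p w : wsum (map (shift p) w) = wsum w.
Proof. unfold wsum. rewrite map_map. f_equal. apply map_ext. now intros [[q n] k]. Qed.

Lemma wsum_app w w' : wsum (w ++ w') = wsum w + wsum w'.
Proof. unfold wsum. now rewrite map_app, list_sum_app. Qed.

Lemma lamc_rlams n r : lamc (rlams n r) = n + lamc r.
Proof. induction n; simpl; lia. Qed.

Lemma lamc_rapps bags : forall r,
  lamc (fold_left RApp bags r) = lamc r + list_sum (map (fun l => list_sum (map lamc l)) bags).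
Proof. induction bags as [|l bags IH]; intros r; simpl; [lia|]. rewrite IH. simpl. lia. Qed.

(** Each head step uses up one abstraction, and those that remain are the prefixes of the explored
    nodes; this is why [wsum] counts prefixes along with annotations. *)
Lemma good_lamc :
  (forall t r n k w, good t r n k w -> lamc r = n + k + wsum w) /\
  (forall args bags w, goods args bags w ->
     list_sum (map (fun l => list_sum (map lamc l)) bags) = wsum w).
Proof.
  apply good_goods_ind; simpl.
  - intros n y i args bags w _ H. unfold rhnf. rewrite lamc_rlams, lamc_rapps, wsum_shift. simpl. lia.
  - intros t r t' r' n k w H _ IH. rewrite (rhstep_lamc _ _ _ _ H). lia.
  - reflexivity.
  - auto.
  - intros a args b bags n k wa w _ IH _ IHs.
    rewrite IH, IHs. unfold wsum at 3. simpl.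
    fold (wsum (map (shift (repeat 1 (length args) ++ [2])) wa ++ w)).
    rewrite wsum_app, wsum_shift. lia.
Qed.

Definition wle : list entry -> list entry -> Prop :=
  Forall2 (fun e e' => fst e = fst e' /\ snd e' <= snd e).

Lemma wle_shift p w w' : wle w w' -> wle (map (shift p) w) (map (shift p) w').
Proof.
  induction 1 as [|[[q n] k] [[q' n'] k'] w w' [E H] _ IH]; simpl; constructor; auto.
  simpl in *. now inversion E.
Qed.

Inductive rparss : list term -> list (list rterm) -> list term -> list (list rterm) -> Prop :=
| rparss_nil : rparss [] [] [] []
| rparss_cons a args l bags a' args' l' bags' : rpars a l a' l' -> rparss args bags args' bags' ->
    rparss (a :: args) (l :: bags) (a' :: args') (l' :: bags').

Lemma rpar_apps args : forall bags h g s r', length bags = length args -> neutral h ->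
  rpar (apps h args) (fold_left RApp bags g) s r' ->
  exists h' g' args' bags', s = apps h' args' /\ r' = fold_left RApp bags' g' /\
    rpar h g h' g' /\ rparss args bags args' bags'.
Proof.
  induction args as [|a args IH]; intros [|l bags] h g s r' E Hn H; try discriminate; simpl in *.
  - exists s, r', [], []. repeat split; auto. constructor.
  - apply IH in H; [|lia|intros P; discriminate].
    destruct H as [h' [g' [args' [bags' [-> [-> [Hh Hs]]]]]]].
    inversion Hh; subst; [|now destruct (Hn A)].
    exists M', r', (N' :: args'), (l' :: bags'). repeat split; auto. now constructor.
Qed.

Lemma rpar_hnf n y i args bags s r' : length bags = length args ->
  rpar (hnf_of n y args) (rhnf n y i bags) s r' ->
  exists args' bags', s = hnf_of n y args' /\ r' = rhnf n y i bags' /\ rparss args bags args' bags'.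
Proof.
  unfold rhnf. intros E. revert s r'. induction n as [|n IH]; intros s r' H; simpl in *.
  - apply rpar_apps in H; [|assumption|intros P; discriminate].
    destruct H as [h' [g' [args' [bags' [-> [-> [Hh Hs]]]]]]].
    inversion Hh; subst. now exists args', bags'.
  - inversion H as [|? ? ? ? Hb| |]; subst. destruct (IH _ _ Hb) as [args' [bags' [-> [-> ?]]]].
    now exists args', bags'.
Qed.

Lemma goods_length args bags w : goods args bags w -> length bags = length args.
Proof. induction 1; simpl; auto. Qed.

Lemma rparss_length args bags args' bags' : rparss args bags args' bags' -> length args = length args'.
Proof. induction 1; simpl; auto. Qed.

(** Explored nodes keep their positions and prefixes under a parallel step, and by [rpar_rhstep]
    each head step is absorbed or matched by a single one, so no annotation grows. *)
Lemma good_rpar :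
  (forall t r n k w, good t r n k w -> forall s r', rpar t r s r' ->
     exists k' w', k' <= k /\ wle w w' /\ good s r' n k' w') /\
  (forall args bags w, goods args bags w -> forall args' bags', rparss args bags args' bags' ->
     exists w', wle w w' /\ goods args' bags' w').
Proof.
  apply good_goods_ind.
  - intros n y i args bags w Hg IH s r' H.
    apply rpar_hnf in H; [|eapply goods_length; eassumption].
    destruct H as [args' [bags' [-> [-> H]]]]. destruct (IH _ _ H) as [w' [Hw Hg']].
    exists 0, (map (shift (repeat 0 n)) w'). repeat split; auto; [now apply wle_shift|now constructor].
  - intros t r t' r' n k w H Hg IH s rs Hp.
    destruct (rpar_rhstep _ _ _ _ H) with (s := s) (r' := rs) as [Hp'|[s1 [r1 [Hs [Hp' _]]]]]; auto.
    + eapply rhstep_thrifty; [eassumption|]. eapply (proj1 good_thrifty); eassumption.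
    + destruct (IH _ _ Hp') as [k' [w' [? [? ?]]]]. exists k', w'. auto.
    + destruct (IH _ _ Hp') as [k' [w' [? [? ?]]]]. exists (S k'), w'.
      split; [lia|]. split; [assumption|]. econstructor; eassumption.
  - intros args' bags' H. inversion H; subst. exists []. split; constructor.
  - intros a args bags w _ IH args' bags' H. inversion H as [|? ? ? ? ? ? ? ? Hl Hs]; subst.
    inversion Hl; subst.
    destruct (IH _ _ Hs) as [w' [? ?]]. exists w'. split; [assumption|now constructor].
  - intros a args b bags n k wa w _ IH _ IHs args' bags' H.
    inversion H as [|? ? ? ? ? ? ? ? Hl Hs]; subst.
    inversion Hl as [|? ? ? ? ? ? Hb Hl']; subst. inversion Hl'; subst.
    destruct (IH _ _ Hb) as [k' [wa' [? [? Hga]]]]. destruct (IHs _ _ Hs) as [w' [? ?]].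
    eexists. split; [|apply goods_cons; eassumption].
    rewrite (rparss_length _ _ _ _ Hs). apply Forall2_app; [|assumption].
    apply wle_shift. constructor; auto.
Qed.

(** [m] is the length of the reduction. It is fixed before the approximant, so one bound serves
    explorations of every depth. *)
Lemma good_star t s : beta_star t s -> exists m, forall r n k w, good t r n k w ->
  exists r' k' w', k' <= k /\ wle w w' /\ good s r' n k' w' /\ k + wsum w <= m + (k' + wsum w').
Proof.
  intros H. apply clos_rt_rt1n in H. induction H as [t|t t' s H _ [m IH]].
  - exists 0. intros r n k w H. exists r, k, w. split; [lia|]. split; [|split; [assumption|lia]].
    clear H. induction w; constructor; auto.
  - exists (S m). intros r n k w Hg.
    destruct (thrifty_beta _ _ H r) as [r1 [Hp Hl]]; [eapply (proj1 good_thrifty); eassumption|].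
    destruct (proj1 good_rpar _ _ _ _ _ Hg _ _ Hp) as [k1 [w1 [Hk1 [Hw1 Hg1]]]].
    destruct (IH _ _ _ _ Hg1) as [r2 [k2 [w2 [Hk2 [Hw2 [Hg2 Hle]]]]]].
    exists r2, k2, w2. split; [lia|]. split; [|split; [assumption|]].
    + clear -Hw1 Hw2. revert w2 Hw2. induction Hw1 as [|e e1 w w1 [E1 L1] _ IH]; intros w2 H;
        inversion H as [|? e2 ? w2' [E2 L2]]; subst; constructor; [|now apply IH].
      split; [congruence|lia].
    (* The prefix length [n] is common to both sides, so losing at most one abstraction lowers
       [k + wsum w] by at most one. *)
    + apply (proj1 good_lamc) in Hg, Hg1. lia.
Qed.

(** * Approximants of simple terms *)

(** [idx0] for an arbitrary variable, as needed when an induction passes under binders. *)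
Definition idx (x : nat) (F : list (nat * nat)) : list nat :=
  flat_map (fun o => if fst o =? x then [snd o] else []) F.

Lemma idx_app x F G : idx x (F ++ G) = idx x F ++ idx x G.
Proof. apply flat_map_app. Qed.

Lemma idx_down x F : idx x (down F) = idx (S x) F.
Proof.
  unfold idx, down. rewrite flat_map_flat_map. apply flat_map_ext_in.
  intros [[|y] i] _; simpl; [reflexivity|apply app_nil_r].
Qed.

Lemma idx_zero F : idx 0 F = idx0 F.
Proof. apply flat_map_ext_in. now intros [[|y] i] _. Qed.

(** The counterpart, for approximants, of a substitution that replaces [x] and renames every other
    variable by [z]; [rinst] is the case [x = 0], [z = pred]. *)
Definition sub_var_or (x : nat) (z : nat -> nat) (l : list rterm) (y i : nat) : rterm :=
  if y =? x then nth i l rdefault else RVar (z y) i.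

Lemma map_rren_inv xi t l : (forall b, In b l -> apx (ren xi t) b) ->
  exists l0, l = map (rren xi) l0 /\ forall b, In b l0 -> apx t b.
Proof.
  induction l as [|b l IH]; intros H.
  - exists []. split; [reflexivity|intros b []].
  - destruct IH as [l0 [-> Hl]]; [intros; apply H; now right|].
    destruct (apx_rren_inv t xi b) as [b0 [-> Hb]]; [apply H; now left|].
    exists (b0 :: l0). split; [reflexivity|]. intros c [<-|Hc]; auto.
Qed.

(* The occurrences of x in the preimage a are numbered from m on, in
   order; [pre] and [post] hold the copies used elsewhere. *)
Lemma apx_sub_inv A : forall s x z, (forall y, y <> x -> s y = Var (z y)) ->
  forall r, apx (sub s A) r -> forall m, exists a l,
    apx A a /\ (forall b, In b l -> apx (s x) b) /\ idx x (fv a) = seq m (length l) /\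
    forall pre post, length pre = m -> rsub (sub_var_or x z (pre ++ l ++ post)) a = r.
Proof.
  induction A as [y|A IH|M IH N IH']; simpl; intros s x z Hs r H m.
  - destruct (Nat.eq_dec y x) as [->|Hy].
    + exists (RVar x m), [r]. repeat split.
      * constructor.
      * now intros b [<-|[]].
      * unfold idx. simpl. now rewrite Nat.eqb_refl.
      * intros pre post <-. unfold sub_var_or. simpl. rewrite Nat.eqb_refl.
        now rewrite app_nth2, Nat.sub_diag by lia.
    + rewrite (Hs y Hy) in H. inversion H; subst. exists (RVar y i), []. repeat split.
      * constructor.
      * intros b [].
      * unfold idx. simpl. now apply Nat.eqb_neq in Hy as ->.
      * intros pre post _. unfold sub_var_or. simpl. now apply Nat.eqb_neq in Hy as ->.
  - inversion H as [|A0 a0 Ha|]; subst.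
    destruct (IH (up s) (S x) (fun y => match y with 0 => 0 | S y => S (z y) end)) with (r := a0) (m := m)
      as [a [l' [H1 [H2 [H3 H4]]]]]; [|assumption|].
    { intros [|y] Hy; simpl; [reflexivity|]. now rewrite Hs by lia. }
    destruct (map_rren_inv _ _ _ H2) as [l [-> Hl]].
    exists (RLam a), l. repeat split; auto.
    + now constructor.
    + simpl. rewrite idx_down. now rewrite H3, length_map.
    + intros pre post E. simpl. f_equal.
      rewrite <- (H4 (map (rren S) pre) (map (rren S) post)) by now rewrite length_map.
      apply rsub_ext. intros [|y] i; [reflexivity|]. unfold sub_var_or. simpl.
      destruct (y =? x); [|reflexivity]. rewrite <- !map_app.
      change rdefault with (rren S rdefault) at 2. now rewrite map_nth.
  - inversion H as [| |M0 N0 r0 l0 H0 Hl0]; subst.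
    destruct (IH s x z Hs r0 H0 m) as [a [l1 [H1 [H2 [H3 H4]]]]].
    (* The numbering runs on through the members of a bag: copies used by earlier members are moved
       into [pre], those of later ones into [post]. *)
    assert (forall m, exists bs l, (forall b, In b bs -> apx N b) /\ (forall b, In b l -> apx (s x) b) /\
      idx x (flat_map fv bs) = seq m (length l) /\
      forall pre post, length pre = m -> map (rsub (sub_var_or x z (pre ++ l ++ post))) bs = l0)
      as HL.
    { clear - IH' Hs Hl0. induction l0 as [|c l0 IH]; intros m.
      - exists [], []. repeat split; auto; intros b [].
      - destruct (IH' s x z Hs c (Hl0 c (or_introl eq_refl)) m) as [a [l1 [H1 [H2 [H3 H4]]]]].
        destruct (IH (fun b Hb => Hl0 b (or_intror Hb)) (m + length l1)) as [bs [l2 [H5 [H6 [H7 H8]]]]].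
        exists (a :: bs), (l1 ++ l2). repeat split.
        + intros b [<-|Hb]; auto.
        + intros b Hb. apply in_app_or in Hb. destruct Hb; auto.
        + simpl. now rewrite idx_app, H3, H7, length_app, seq_app.
        + intros pre post E. simpl. f_equal.
          * rewrite <- app_assoc. now apply H4.
          * rewrite <- (H8 (pre ++ l1) post) by (rewrite length_app; lia). now rewrite <- !app_assoc. }
    destruct (HL (m + length l1)) as [bs [l2 [H5 [H6 [H7 H8]]]]].
    exists (RApp a bs), (l1 ++ l2). repeat split.
    + now constructor.
    + intros b Hb. apply in_app_or in Hb. destruct Hb; auto.
    + simpl. now rewrite idx_app, H3, H7, length_app, seq_app.
    + intros pre post E. simpl. f_equal.
      * rewrite <- app_assoc. now apply H4.
      * rewrite <- (H8 (pre ++ l1) post) by (rewrite length_app; lia). now rewrite <- !app_assoc.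
Qed.

(** Expansion of approximants: the pieces of [r] standing where [B] was substituted are collected
    into a bag, and each occurrence is labelled by the place of its piece there. *)
Lemma apx_subst_inv A B r : apx (subst 0 B A) r ->
  exists a l, apx A a /\ (forall b, In b l -> apx B b) /\ linear a l /\ rsub (rinst l) a = r.
Proof.
  rewrite subst_inst. intros H.
  destruct (apx_sub_inv A (inst B) 0 pred) with (r := r) (m := 0) as [a [l [H1 [H2 [H3 H4]]]]];
    [intros [|y] Hy; [lia|reflexivity]|assumption|].
  exists a, l. repeat split; auto.
  - unfold linear. now rewrite <- idx_zero, H3.
  - rewrite <- (H4 [] []) by reflexivity. apply rsub_ext.
    intros [|y] i; unfold sub_var_or; simpl; now rewrite ?app_nil_r.
Qed.

Lemma idx_no_occ t r : apx t r -> forall x, occ x t = 0 -> idx x (fv r) = [].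
Proof.
  induction 1 as [y i|A a _ IH|M N r l _ IH _ IHl]; simpl; intros x E.
  - unfold idx. simpl. destruct (y =? x); [discriminate|reflexivity].
  - rewrite idx_down. auto.
  - rewrite idx_app, IH by lia. induction l as [|b l IHl']; simpl; [reflexivity|].
    rewrite idx_app, IHl by (simpl; auto; lia). apply IHl'. intros; apply IHl; simpl; auto.
Qed.

Lemma nf_of_occ A : forall s x, 0 < occ x A -> beta_nf (sub s A) -> beta_nf (s x).
Proof.
  induction A as [y|A IH|M IH N IH']; simpl; intros s x Ho H.
  - destruct (Nat.eqb_spec y x); [now subst|lia].
  - apply nf_lam_inv in H. apply (IH _ _ Ho) in H. simpl in H.
    intros u Hu. exact (H _ (beta_ren _ _ Hu S)).
  - apply nf_app_inv in H. destruct H. destruct (occ x M) eqn:E.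
    + now apply IH'.
    + apply IH; [lia|assumption].
Qed.

(** A single occurrence of [x] can be multiplied only by lying inside an argument with several
    copies. Thriftiness makes the instance of such an argument normal, and then [s x] would be
    normal too. *)
Lemma idx_occ_le_one t r : apx t r -> forall s rs x, thrifty (sub s t) (rsub rs r) -> occ x t <= 1 ->
  ~ beta_nf (s x) -> length (idx x (fv r)) <= 1.
Proof.
  induction 1 as [y i|A a _ IH|M N r l Hr IH Hl IHl]; simpl; intros s rs x H Ho Hn.
  - unfold idx. simpl. destruct (y =? x); simpl; lia.
  - inversion H; subst. rewrite idx_down. eapply IH; [eassumption|assumption|].
    simpl. intros Hnf. apply Hn. rewrite ren_as_sub in Hnf. eapply nf_sub_inv; eassumption.
  - inversion H as [| |M0 N0 r0 l0 H1 H2 H3 H4]; subst. rewrite idx_app.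
    destruct (Nat.eq_dec (occ x N) 0) as [E|E].
    + assert (idx x (flat_map fv l) = []) as ->.
      { clear - Hl E. induction l as [|b l IHl']; simpl; [reflexivity|].
        rewrite idx_app, (idx_no_occ N b) by (simpl in *; auto). apply IHl'. intros; apply Hl; simpl; auto. }
      rewrite app_nil_r. eapply IH; [eassumption|lia|assumption].
    + rewrite (idx_no_occ _ _ Hr) by lia. simpl. rewrite length_map in H3.
      destruct H3 as [H3|H3].
      * exfalso. apply Hn. eapply nf_of_occ; [|eassumption]. lia.
      * destruct l as [|b [|c l]]; simpl in H3; [simpl; lia| |lia].
        simpl. rewrite app_nil_r. eapply IHl; [now left| |lia|eassumption].
        apply H2. simpl. now left.
Qed.

(** Here simplicity of redexes enters: if the argument is not normal, its variable occurs at most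
    once, and the bag found by [apx_subst_inv] has at most one copy. *)
Lemma rhstep_expand t t' A B : hstep_r t t' A B -> simple_redex A B ->
  forall r', thrifty t' r' -> exists r, rhstep t r t' r'.
Proof.
  induction 1 as [A B|M M' A B _ IH|M M' N A B Hn _ IH]; intros Hs r' H.
  - destruct (apx_subst_inv A B r' (thrifty_apx _ _ H)) as [a [l [H1 [H2 [H3 <-]]]]].
    exists (RApp (RLam a) l). constructor; auto.
    destruct (classic (beta_nf B)) as [Hnf|Hnf]; [now left|right].
    destruct Hs as [Ho|]; [|contradiction].
    rewrite <- (length_seq (length l) 0), <- (Permutation_length H3), <- idx_zero.
    rewrite subst_inst in H. eapply idx_occ_le_one; eassumption.
  - inversion H; subst. destruct (IH Hs _ H1) as [r ?]. exists (RLam r). now constructor.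
  - inversion H as [| |M0 N0 r0 l0 H1 H2 H3 H4]; subst. destruct (IH Hs _ H1) as [r ?].
    exists (RApp r l0). constructor; auto. intros; now apply thrifty_apx; auto.
Qed.

(** * Covering the annotated positions of a simple term *)

Lemma annot_step t t' p j : hstep t t' -> annot t p j -> p <> [] -> annot t' p j.
Proof.
  intros H Ha Hp. apply annot_inv in Ha.
  destruct Ha as [k [n [y [args [Hk [[-> _]|[i [a [q [-> [Hi Ha]]]]]]]]]]]; [contradiction|].
  inversion Hk as [|k0 t0 t2 u H1 H2]; subst.
  - exfalso. eapply hnf_no_hstep; eassumption.
  - rewrite (hstep_det _ _ _ H1 H) in H2. econstructor; eassumption.
Qed.

Lemma annot_step_inv t t' p j : hstep t t' -> annot t' p j -> p <> [] -> annot t p j.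
Proof.
  intros H Ha Hp. apply annot_inv in Ha.
  destruct Ha as [k [n [y [args [Hk [[-> _]|[i [a [q [-> [Hi Ha]]]]]]]]]]]; [contradiction|].
  econstructor; [econstructor; eassumption|eassumption|assumption].
Qed.

Lemma annot_step_root t t' k : hstep t t' -> annot t' [] k -> annot t [] (S k).
Proof.
  intros H Ha. apply annot_inv in Ha.
  destruct Ha as [k0 [n [y [args [Hk [[_ ->]|[i [a [q [E _]]]]]]]]]].
  - econstructor. econstructor; eassumption.
  - exfalso. symmetry in E. exact (arg_position_not_nil _ _ _ E).
Qed.

Lemma in_shift p w q n k : In (q, n, k) (map (shift p) w) -> exists q0, q = p ++ q0 /\ In (q0, n, k) w.
Proof.
  intros H. apply in_map_iff in H. destruct H as [[[q0 n0] k0] [E H]].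
  inversion E; subst. eauto.
Qed.

Lemma in_shift_intro p w q n k : In (q, n, k) w -> In (p ++ q, n, k) (map (shift p) w).
Proof. intros H. apply in_map_iff. exists (q, n, k). auto. Qed.

(** Explorations record genuine annotations. The root is kept apart from [w], since a head step
    changes its annotation and no other. *)
Lemma good_annot :
  (forall t r n k w, good t r n k w -> annot t [] k /\
     forall p m j, In (p, m, j) w -> p <> [] /\ annot t p j) /\
  (forall args bags w, goods args bags w -> forall p m j, In (p, m, j) w ->
     exists i a q, p = repeat 1 (length args - 1 - i) ++ [2] ++ q /\
       nth_error args i = Some a /\ annot a q j).
Proof.
  apply good_goods_ind.
  - intros n y i args bags w _ IH.
    split; [econstructor; constructor|].
    intros p m j H. apply in_shift in H. destruct H as [q0 [-> H]].
    destruct (IH _ _ _ H) as [i0 [a [q [-> [Hi Ha]]]]]. split; [apply arg_position_not_nil|].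
    econstructor; [constructor|eassumption|assumption].
  - intros t r t' r' n k w H _ [IH IH']. apply rhstep_hstep in H. split.
    + eapply annot_step_root; eassumption.
    + intros p m j Hp. destruct (IH' _ _ _ Hp). split; [assumption|].
      eapply annot_step_inv; eassumption.
  - intros p m j [].
  - intros a args bags w _ IH p m j H. destruct (IH _ _ _ H) as [i [b [q [-> [Hi Hb]]]]].
    exists (S i), b, q. split; [|auto]. simpl. do 2 f_equal. lia.
  - intros a args b bags n k wa w _ [IH IH'] _ IHs p m j H. apply in_app_or in H. destruct H as [H|H].
    + apply in_shift in H. destruct H as [q [-> H]].
      exists 0, a, q. rewrite <- app_assoc. split; [simpl; do 2 f_equal; lia|]. split; [reflexivity|].
      destruct H as [E|H]; [now inversion E; subst|]. now apply (IH' q m j).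
    + destruct (IHs _ _ _ H) as [i [c [q [-> [Hi Hc]]]]].
      exists (S i), c, q. split; [|auto]. simpl. do 2 f_equal. lia.
Qed.

(** Each descent into an argument contributes one 2, so at an annotated position this is the depth
    of the node in the Böhm tree. *)
Definition twos (p : list nat) : nat := count_occ Nat.eq_dec p 2.

Lemma twos_app p q : twos (p ++ q) = twos p + twos q.
Proof. apply count_occ_app. Qed.

Lemma annot_has_hnf t p j : annot t p j -> has_hnf t.
Proof.
  intros H. apply annot_inv in H. destruct H as [k [n [y [args [H _]]]]]. now exists k, n, y, args.
Qed.

(** Arguments with no annotation within reach, for lack of an hnf or because [d] is 0, get an empty
    bag; each of the others gets one approximant covering its positions of depth below [d]. *)
Lemma goods_cover d args :
  (forall a, In a args -> has_hnf a -> 0 < d -> exists r n k w, good a r n k w /\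
     forall q j, annot a q j -> q <> [] -> twos q < d -> exists m, In (q, m, j) w) ->
  exists bags w, goods args bags w /\ forall i a q j, nth_error args i = Some a -> annot a q j ->
    twos q < d -> exists m, In (repeat 1 (length args - 1 - i) ++ [2] ++ q, m, j) w.
Proof.
  induction args as [|a args IH]; intros H.
  - exists [], []. split; [constructor|]. intros [|i] a q j E; discriminate.
  - destruct IH as [bags [w [Hg Hw]]]; [intros; apply H; simpl; auto|].
    assert (Hw' : forall i b q j, nth_error args i = Some b -> annot b q j -> twos q < d ->
      exists m, In (repeat 1 (length (a :: args) - 1 - S i) ++ [2] ++ q, m, j) w).
    { intros i b q j Hi Hb Hq. destruct (Hw i b q j Hi Hb Hq) as [m Hm]. exists m.
      replace (length (a :: args) - 1 - S i) with (length args - 1 - i) by (simpl; lia). assumption. }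
    (* Having an hnf is undecidable, hence the classical case distinction. *)
    destruct (classic (has_hnf a /\ 0 < d)) as [[Ha Hd]|Hna].
    + destruct (H a (or_introl eq_refl) Ha Hd) as [r [n [k [wa [Hga Hwa]]]]].
      eexists _, _. split; [apply goods_cons; eassumption|].
      intros [|i] b q j Hi Hb Hq.
      * inversion Hi; subst b.
        assert (exists m, In (q, m, j) (([], n, k) :: wa)) as [m Hm].
        { destruct q as [|c q].
          - exists n. left. f_equal. eapply annot_fun; [|eassumption].
            apply (proj1 good_annot) in Hga. tauto.
          - destruct (Hwa _ _ Hb) as [m Hm]; [discriminate|assumption|]. exists m. now right. }
        exists m. apply in_or_app. left.
        replace (length (a :: args) - 1 - 0) with (length args) by (simpl; lia).
        rewrite app_assoc. now apply in_shift_intro.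
      * destruct (Hw' i b q j Hi Hb Hq) as [m Hm]. exists m. apply in_or_app. now right.
    + exists ([] :: bags), w. split; [now constructor|].
      intros [|i] b q j Hi Hb Hq; [|eauto].
      exfalso. inversion Hi; subst b. apply Hna. split; [now apply annot_has_hnf in Hb|lia].
Qed.

(** The simple head steps are undone one by one with [rhstep_expand]; only the root annotation
    changes. *)
Lemma good_expand t u : hred_simple t u -> forall r n k w, good u r n k w -> exists r' k',
  good t r' n k' w /\ forall p j, annot t p j -> p <> [] -> annot u p j.
Proof.
  induction 1 as [t|t t' u A B H Hs _ IH]; intros r n k w Hg.
  - exists r, k. auto.
  - destruct (IH _ _ _ _ Hg) as [r1 [k1 [Hg1 Ha]]].
    destruct (rhstep_expand _ _ _ _ H Hs r1) as [r0 H0]; [eapply (proj1 good_thrifty); eassumption|].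
    exists r0, (S k1). split; [econstructor; eassumption|].
    intros p j Hp Hne. apply Ha; [|assumption]. eapply annot_step; [|eassumption|assumption].
    now exists A, B.
Qed.

(** Induction on the depth unfolds the coinductive [simple] only as far as needed: the arguments of
    the hnf are covered to depth [d - 1], and the hnf is then expanded back along the head
    reduction. *)
Lemma simple_good d : forall t, simple t -> has_hnf t -> exists r n k w, good t r n k w /\
  forall p j, annot t p j -> p <> [] -> twos p <= d -> exists m, In (p, m, j) w.
Proof.
  induction d as [d IH] using lt_wf_ind. intros t Hs Ht.
  inversion Hs as [t0 Hn|t0 n y args Hr Hargs]; subst; [contradiction|].
  destruct (goods_cover d args) as [bags [w [Hg Hw]]].
  { intros a Ha Hh Hd. destruct (IH (pred d)) with (t := a) as [r [n' [k [w [Hg Hw]]]]]; auto; [lia|].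
    exists r, n', k, w. split; [assumption|]. intros q j Hq Hne Hlt. apply Hw; auto. lia. }
  (* The occurrence of the head variable is given index 0; any index would do. *)
  destruct (good_expand _ _ Hr _ _ _ _ (good_hnf n y 0 args bags w Hg)) as [r [k [Hgt Ha]]].
  do 4 eexists. split; [eassumption|].
  intros p j Hp Hne Hd. pose proof (Ha _ _ Hp Hne) as H. apply annot_inv in H.
  destruct H as [k0 [n0 [y0 [args0 [H0 [[E _]|[i [a [q [-> [Hi Hq]]]]]]]]]]]; [contradiction|].
  destruct (hred_hnf_det _ _ _ _ _ _ _ _ _ H0 (hred_0 _)) as [_ [-> [_ ->]]].
  destruct (Hw i a q j Hi Hq) as [m Hm].
  - rewrite !twos_app in Hd. change (twos [2]) with 1 in Hd. lia.
  - exists m. now apply in_shift_intro.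
Qed.

(** * Counting the positions whose annotation drops *)

(** Corresponding entries share their position, and each strict drop lowers the sum by at least one;
    [dl] collects the positions of the drops. *)
Lemma wle_decreases w w' : wle w w' -> exists dl : list (list nat),
  length dl + wsum w' <= wsum w /\
  forall p m k, In (p, m, k) w -> (forall m' k', In (p, m', k') w' -> k' < k) -> In p dl.
Proof.
  induction 1 as [|[[p n] k] [[p' n'] k'] w w' [E Hk] _ [dl [Hl Hd]]].
  - exists []. split; [simpl; lia|]. intros p m k [].
  - simpl in E, Hk. inversion E; subst p' n'. unfold wsum in *. simpl.
    (* If the two annotations agree, the entry of [w'] itself refutes a strict decrease at this
       entry, so nothing is added. *)
    destruct (Nat.eq_dec k k') as [<-|Hne].
    + exists dl. split; [lia|]. intros q m j [Eq|H] Hlt.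
      * inversion Eq; subst. specialize (Hlt m j (or_introl eq_refl)). lia.
      * apply (Hd q m j H). intros m' j' H'. apply (Hlt m'). now right.
    + exists (p :: dl). split; [simpl; lia|]. intros q m j [Eq|H] Hlt.
      * inversion Eq; subst. now left.
      * right. apply (Hd q m j H). intros m' j' H'. apply (Hlt m'). now right.
Qed.

Lemma infinite_set_NoDup {T : Type} (P : T -> Prop) : infinite_set P ->
  forall m, exists l, length l = m /\ NoDup l /\ forall x, In x l -> P x.
Proof.
  intros H. induction m as [|m [l [E [Hn Hl]]]].
  - exists []. repeat split; [constructor|intros x []].
  - destruct (H l) as [x [Hx Hx']]. exists (x :: l). split; [simpl; congruence|]. split.
    + now constructor.
    + intros y [<-|Hy]; auto.
Qed.

Lemma twos_bounded l : exists d, forall p, In p l -> twos p <= d.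
Proof.
  induction l as [|q l [d Hd]].
  - exists 0. intros p [].
  - exists (twos q + d). intros p [<-|Hp]; [lia|]. specialize (Hd p Hp). lia.
Qed.

Lemma star_conv t s : beta_star t s -> beta_conv t s.
Proof.
  induction 1; [now apply rst_step|apply rst_refl|eapply rst_trans; eassumption].
Qed.

Theorem theorem6p11 (M N : term) :
  (exists M' N' : term,
      beta_star N N' /\ beta_star M M' /\ simple M' /\ bt_eq M' N' /\
      infinite_set (fun p : list nat =>
        exists k1 k2 : nat, annot M' p k1 /\ annot N' p k2 /\ k1 > k2)) ->
  ~ beta_conv M N.
Proof.
  intros [M' [N' [HN [HM [Hs [_ Hinf]]]]]] Hconv.
  assert (beta_conv M' N') as Hconv'.
  { apply rst_trans with M; [now apply rst_sym, star_conv|].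
    apply rst_trans with N; [assumption|now apply star_conv]. }
  destruct (church_rosser _ _ Hconv') as [L [HML HNL]].
  destruct (good_star _ _ HML) as [m Hm].
  (* [m] bounds the total decrease on the way from [M'] to [L]; one position more than that is
     chosen. *)
  destruct (infinite_set_NoDup _ Hinf (S m)) as [ps [Hlen [Hnd Hps]]].
  destruct (twos_bounded ps) as [d Hd].
  assert (has_hnf M') as Hh.
  { destruct (Hinf []) as [p [[k1 [k2 [H1 _]]] _]]. eapply annot_has_hnf; eassumption. }
  (* The exploration is deep enough to contain all chosen positions. *)
  destruct (simple_good d M' Hs Hh) as [r [n [k [w [Hg Hw]]]]].
  destruct (Hm _ _ _ _ Hg) as [r' [k' [w' [Hk [Hwle [Hg' Hsum]]]]]].
  apply (proj1 good_annot) in Hg, Hg'. destruct Hg as [Hroot _], Hg' as [Hroot' Hannot'].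
  destruct (wle_decreases (([], n, k) :: w) (([], n, k') :: w')) as [dl [Hdl Hin]].
  { now constructor. }
  assert (incl ps dl) as Hincl.
  { intros p Hp. destruct (Hps p Hp) as [k1 [k2 [H1 [H2 Hlt]]]].
    destruct (star_annot _ _ _ _ HNL H2) as [k3 [Hk3 H3]].
    assert (exists m', In (p, m', k1) (([], n, k) :: w)) as [m' Hm'].
    { destruct p as [|c p].
      - exists n. left. f_equal. eapply annot_fun; eassumption.
      - destruct (Hw _ _ H1) as [m' Hm']; [discriminate|now apply Hd|]. exists m'. now right. }
    apply (Hin p m' k1 Hm'). intros m2 k4 H4.
    assert (annot L p k4) as H5.
    { destruct H4 as [E|H4]; [now inversion E; subst|]. now apply (Hannot' p m2 k4). }
    (* [k4 = k3 <= k2 < k1], where [k3] is the annotation of [L] obtained from that of [N']. *)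
    rewrite (annot_fun _ _ _ H5 _ H3). lia. }
  (* [S m] distinct positions lie in [dl], whereas the total decrease is at most [m]. *)
  pose proof (NoDup_incl_length Hnd Hincl). unfold wsum in *. simpl in Hdl. lia.
Qed.
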